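(* Let $(M,g,\nabla)$ be a Lorentzian geometry with parallel skew-symmetric torsion $T$ carrying a $\nabla$-parallel isotropic vector field $p$ and such that $T=p\wedge\omega$, where $\omega\in\wedge^2E$ is a $\nabla^E$-parallel bivector on the screen bundle $E=p^\perp/\langle p\rangle$. Let $x\in M$. Then the holonomy algebras $\mathfrak{hol}_x(\nabla^E)$ and $\mathfrak{hol}_x(\nabla^{g,E})$ coincide.
   Context: A Lorentzian geometry with parallel skew-symmetric torsion is a triple $(M,g,\nabla)$, where $g$ is a Lorentzian metric on a smooth manifold $M$ and $\nabla$ is a connection with torsion $T$ such that $\nabla g=0$, $\nabla T=0$ and $T(X,Y,Z)=g(T(X,Y),Z)$ is totally skew-symmetric; $\nabla=\nabla^g+\frac12T$, where $\nabla^g$ is the Levi-Civita connection. Forms and multivectors are identified by means of $g$. Isotropic vector fields are understood to be non-zero. The equality $T=p\wedge\omega$ means $T(X,Y)=g(p,X)\omega(Y)-g(p,Y)\omega(X)+\omega(X,Y)p$ (using a lift of $\omega$ to $\wedge^2p^\perp$; $p\wedge\omega$ does not depend on the lift). In this situation $p$ is also $\nabla^g$-parallel, so $p^\perp$ is parallel for both $\nabla$ and $\nabla^g$. The connections $\nabla^E$ and $\nabla^{g,E}$ on $E=p^\perp/\langle p\rangle$ are those induced by $\nabla$ and $\nabla^g$, respectively: $\nabla^E_XY$ (resp. $\nabla^{g,E}_XY$) is the projection to $E$ of $\nabla_X\tilde Y$ (resp. $\nabla^g_X\tilde Y$), where $\tilde Y$ is any section of $p^\perp$ projecting to $Y$.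 Both holonomy algebras are subalgebras of $\mathfrak{so}(E_x)$. *)

(* Defs.v *)
(* MathComp-Analysis; all manifolds are real, over an arbitrary R : realType. *)
From HB Require Import structures.
From mathcomp Require Import all_boot all_order all_algebra.
From mathcomp Require Import all_classical all_reals all_analysis.

Set Implicit Arguments.
Unset Strict Implicit.
Unset Printing Implicit Defensive.

Import Order.TTheory GRing.Theory Num.Theory.
Import numFieldNormedType.Exports.
Local Open Scope classical_set_scope.
Local Open Scope ring_scope.

Section Smoothness.
Variables (R : realType) (W : normedModType R).

Fixpoint C_k (n k : nat) (U : set 'rV[R]_n) (f : 'rV[R]_n -> W) : Prop :=
  match k with
  | 0 => forall u, U u -> {for u, continuous f}
  | k'.+1 => (forall u, U u -> differentiable f u) /\
      forall i : 'I_n, C_k k' U (fun u => 'D_(delta_mx 0 i) f u)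
  end.

Definition smooth_on (n : nat) (U : set 'rV[R]_n) (f : 'rV[R]_n -> W) :=
  forall k, C_k k U f.

Definition C1_at (f : R -> W) (t : R) :=
  \forall s \near t, derivable f s 1 /\ {for s, continuous (derive1 f)}.

End Smoothness.

(* An n-dimensional smooth manifold, given by a smooth atlas which need not be
   maximal. [coord c] and [par c] are total functions, meaningful only on
   [dom c] and on [coord c @` dom c] respectively. *)
Record manifold (R : realType) (n : nat) := Manifold {
  point :> topologicalType;
  point_hausdorff : hausdorff_space point;
  point_second_countable : @second_countable point;
  chart : Type;
  dom : chart -> set point;
  coord : chart -> point -> 'rV[R]_n;
  par : chart -> 'rV[R]_n -> point;
  dom_open : forall c, open (dom c);
  coord_open : forall c, open (coord c @` dom c);
  coordK : forall c x, dom c x -> par c (coord c x) = x;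
  coord_continuous : forall c x, dom c x -> {for x, continuous (coord c)};
  par_continuous : forall c u, (coord c @` dom c) u ->
    {for u, continuous (par c)};
  dom_cover : forall x, exists c, dom c x;
  transition_smooth : forall c d,
    smooth_on (coord c @` (dom c `&` dom d)) (coord d \o par c)
}.

Section Fields.
Variables (R : realType) (n : nat) (M : manifold R n).
Implicit Types (c d : chart M) (x : M).

(* [jac c d x] has (i, j) entry the derivative of the j-th coordinate of d
   along the i-th coordinate of c. Components of vectors are row vectors. *)
Definition jac c d x : 'M[R]_n := 'J (coord d \o par c) (coord c x).

Definition partial (a b : nat) c (i : 'I_n) (F : M -> 'M[R]_(a, b)) x :
    'M[R]_(a, b) :=
  'D_(delta_mx 0 i) (F \o par c) (coord c x).

Definition smooth_comp (a b : nat) c (F : M -> 'M[R]_(a, b)) :=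
  smooth_on (coord c @` dom c) (F \o par c).

(* A tensor field is a family, indexed by the charts, of smooth component
   functions on M, subject to the transformation law of its type; the values
   of the c-components outside [dom c] are irrelevant. *)

Record vector_field := VectorField {
  vf :> chart M -> M -> 'rV[R]_n;
  vf_law : forall c d x, dom c x -> dom d x -> vf d x = vf c x *m jac c d x;
  vf_smooth : forall c, smooth_comp c (vf c)
}.

(* A symmetric covariant 2-tensor field. *)
Record sym_form := SymForm {
  sf :> chart M -> M -> 'M[R]_n;
  sf_law : forall c d x, dom c x -> dom d x ->
    sf c x = jac c d x *m sf d x *m (jac c d x)^T;
  sf_smooth : forall c, smooth_comp c (sf c);
  sf_sym : forall c x, dom c x -> (sf c x)^T = sf c x
}.

(* A skew contravariant 2-tensor field, i.e. a section of wedge^2 TM; u /\ v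
   has components u^T *m v - v^T *m u. *)
Record bivector_field := BivectorField {
  bf :> chart M -> M -> 'M[R]_n;
  bf_law : forall c d x, dom c x -> dom d x ->
    bf d x = (jac c d x)^T *m bf c x *m jac c d x;
  bf_smooth : forall c, smooth_comp c (bf c);
  bf_skew : forall c x, dom c x -> (bf c x)^T = - bf c x
}.

(* A connection on TM given by its Christoffel symbols: the (j, k) entry of
   [Gam c x i] is the k-th component of nabla_{d_i} d_j. Hence for a vector
   field X with components in row form, nabla_{d_i} X = d_i X + X *m Gam_i. *)
Record connection := Connection {
  Gam :> chart M -> M -> 'I_n -> 'M[R]_n;
  Gam_law : forall c d x, dom c x -> dom d x -> forall i,
    Gam c x i *m jac c d x = partial c i (jac c d) x +
      \sum_a jac c d x i a *: (jac c d x *m Gam d x a);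
  Gam_smooth : forall c i, smooth_comp c (fun x => Gam c x i)
}.

Section Geometry.
Variables (g : sym_form) (D : connection).

(* The scalar product of the tangent vectors with c-components u and v. *)
Definition ip c x (u v : 'rV[R]_n) : R := (u *m g c x *m v^T) 0 0.

Definition lorentzian := forall c x, dom c x ->
  exists2 P : 'M[R]_n, P \in unitmx &
    P *m g c x *m P^T = diag_mx (\row_i (if val i == 0%N then -1 else 1)).

(* T(d_i, d_j) is the j-th row of [tors c x i]. *)
Definition tors c x (i : 'I_n) : 'M[R]_n :=
  \matrix_(j, k) (D c x i j k - D c x j i k).

Definition T c x (u v : 'rV[R]_n) : 'rV[R]_n :=
  \sum_i u 0 i *: (v *m tors c x i).

Definition torsion_free := forall c x, dom c x ->
  forall u v, T c x u v = 0.

Definition skew_torsion := forall c x, dom c x -> forall u v w,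
  ip c x (T c x u v) w = - ip c x (T c x v u) w /\
  ip c x (T c x u v) w = - ip c x (T c x u w) v.

Definition metric_connection := forall c x, dom c x -> forall i,
  partial c i (g c) x - D c x i *m g c x - g c x *m (D c x i)^T = 0.

Definition parallel_torsion := forall c x, dom c x -> forall l i,
  partial c l (fun y => tors c y i) x + tors c x i *m D c x l
    - D c x l *m tors c x i - \sum_m D c x l i m *: tors c x m = 0.

Definition parallel_field (X : vector_field) := forall c x, dom c x ->
  forall i, partial c i (X c) x + X c x *m D c x i = 0.

(* The covariant derivative of the bivector field w along d_i. *)
Definition nabla_bv (w : bivector_field) c x (i : 'I_n) : 'M[R]_n :=
  partial c i (w c) x + (D c x i)^T *m w c x + w c x *m D c x i.

End Geometry.

Definition levi_civita g D := torsion_free D /\ metric_connection g D.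

Definition parallel_skew_torsion_geometry g D :=
  [/\ lorentzian g, metric_connection g D, parallel_torsion D
    & skew_torsion g D].

Definition isotropic g (p : vector_field) := forall c x, dom c x ->
  p c x != 0 /\ ip g c x (p c x) (p c x) = 0.

Section Screen.
Variables (g : sym_form) (p : vector_field).

Definition perp c x (u : 'rV[R]_n) := ip g c x (p c x) u = 0.

(* u and v have the same class modulo <p>, i.e. the same projection to E when
   they are in the orthogonal of p. *)
Definition eqE c x (u v : 'rV[R]_n) := (u - v <= p c x)%MS.

(* A section of wedge^2 E, for the screen bundle E = p^perp / <p>, is
   represented by a lift w to wedge^2 p^perp. *)
Definition in_wedge_perp (w : bivector_field) := forall c x, dom c x ->
  p c x *m g c x *m w c x = 0.

(* The skew endomorphism omega(X) and the 2-form omega(X, Y) associated by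
   means of g with the bivector w. *)
Definition bv_end (w : bivector_field) c x (u : 'rV[R]_n) : 'rV[R]_n :=
  u *m g c x *m w c x.

Definition bv_form (w : bivector_field) c x (u v : 'rV[R]_n) : R :=
  ip g c x (bv_end w c x u) v.

Definition torsion_is_wedge (D : connection) (w : bivector_field) :=
  forall c x, dom c x -> forall u v : 'rV[R]_n,
  T D c x u v = ip g c x (p c x) u *: bv_end w c x v
    - ip g c x (p c x) v *: bv_end w c x u + bv_form w c x u v *: p c x.

(* nabla^E omega = 0: the derivative of the lift w of omega lies in
   p /\ p^perp, the kernel of wedge^2 p^perp -> wedge^2 E. *)
Definition parallel_on_screen (D : connection) (w : bivector_field) :=
  forall c x, dom c x -> forall i, exists2 a : 'rV[R]_n, perp c x a &
    nabla_bv D w c x i = (p c x)^T *m a - a^T *m p c x.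

(* The rows of e are lifts to the orthogonal of p(x) of a basis of E_x. *)
Definition screen_basis c x (m : nat) (e : 'M[R]_(m, n)) :=
  [/\ forall i, perp c x (row i e),
      forall u, perp c x u -> (u <= col_mx e (p c x))%MS
    & row_free (col_mx e (p c x))].

Definition C1_curve_at (gamma : R -> M) (t : R) :=
  {for t, continuous gamma} /\
  forall c, dom c (gamma t) -> C1_at (coord c \o gamma) t.

(* Piecewise C^1 curves are parametrized by [0, N] with break points at the
   integers. To be C^1 on the closed interval [k, k+1] means to be the
   restriction of a curve which is C^1 near each point of [k, k+1]. *)
Definition piecewise_C1 (N : nat) (gamma : R -> M) :=
  forall k, (k < N)%N -> exists gamma' : R -> M,
    forall t, k%:R <= t <= k.+1%:R ->
      gamma' t = gamma t /\ C1_curve_at gamma' t.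

Definition null_homotopic (N : nat) (gamma : R -> M) x :=
  exists H : R * R -> M,
  [/\ {within `[0, N%:R]%classic `*` `[0, 1]%classic, continuous H},
      forall t, 0 <= t <= N%:R -> H (t, 0) = gamma t /\ H (t, 1) = x
    & forall s, 0 <= s <= 1 -> H (0, s) = x /\ H (N%:R, s) = x].

(* The c-components s c t of a lift to p^perp, along gamma, of a section of E
   which is parallel for the connection induced by D on E: the covariant
   derivative of the lift in the direction of the velocity of gamma projects
   to 0 in E. *)
Definition screen_parallel_along (D : connection) (N : nat) (gamma : R -> M)
    (s : chart M -> R -> 'rV[R]_n) :=
  (forall t, 0 <= t <= N%:R -> forall c, dom c (gamma t) ->
    perp c (gamma t) (s c t) /\
    forall d, dom d (gamma t) -> s d t = s c t *m jac c d (gamma t)) /\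
  (forall k, (k < N)%N ->
    exists (gamma' : R -> M) (s' : chart M -> R -> 'rV[R]_n),
    forall t, k%:R <= t <= k.+1%:R ->
    [/\ gamma' t = gamma t, C1_curve_at gamma' t
      & forall c, dom c (gamma t) ->
        [/\ s' c t = s c t, C1_at (s' c) t
          & eqE c (gamma t)
              (derive1 (s' c) t + s c t *m
                \sum_i derive1 (coord c \o gamma') t 0 i *: D c (gamma t) i)
              0]]).

(* The restricted holonomy group at x of the connection induced by D on E, in
   the basis of E_x given by the rows of e: a stands for the endomorphism
   [e_i] |-> [\sum_j a_ij e_j]. *)
Definition screen_hol0 (D : connection) c x (m : nat) (e : 'M[R]_(m, n)) :
    set 'M[R]_m :=
  [set a | exists (N : nat) (gamma : R -> M),
    [/\ gamma 0 = x /\ gamma N%:R = x, piecewise_C1 N gamma,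
        null_homotopic N gamma x
      & forall i, exists2 s : chart M -> R -> 'rV[R]_n,
          screen_parallel_along D N gamma s &
          eqE c x (s c 0) (row i e) /\ eqE c x (s c N%:R) (row i (a *m e))]].

End Screen.

Definition mexp (m : nat) (A : 'M[R]_m) : 'M[R]_m :=
  limn (series (fun k => (k`!%:R)^-1 *: (A ^+ k))).

(* The restricted holonomy group is the identity component of the holonomy
   group, so both have the Lie algebra of all A with exp (tA) in the former
   for every t. *)
Definition screen_hol_algebra (g : sym_form) (p : vector_field)
    (D : connection) c x (m : nat) (e : 'M[R]_(m, n)) : set 'M[R]_m :=
  [set A | forall t : R, screen_hol0 g p D c x e (mexp (t *: A))].

End Fields.

(* Main.v *)
From HB Require Import structures.
Require Import Defs.
From mathcomp Require Import all_boot all_order all_algebra.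
From mathcomp Require Import all_classical all_reals all_analysis.
From mathcomp Require Import ring lra.

(* The form theta = g(p, .) is closed, because p is parallel for the Levi-Civita
   connection, and nabla^E - nabla^{g,E} = 1/2 theta (x) omega, because
   nabla - nabla^g = T / 2. Let s be a nabla^E-parallel frame along a
   null-homotopic loop. As omega is nabla^E-parallel, omega s = B s with a
   constant matrix B, so exp (h B) s is nabla^{g,E}-parallel when h is the
   primitive of 1/2 theta along the loop that vanishes at the start. Since theta
   is closed, h also vanishes at the end, and both connections have the same
   parallel transport along the loop: already their restricted holonomy groups
   coincide. The converse is the same argument with -1/2.

   The closed form enters only through its local primitives; along the loop, h
   is obtained by gluing them over the rectangle of a null-homotopy, which is
   merely continuous. *)

Set Implicit Arguments.
Unset Strict Implicit.
Unset Printing Implicit Defensive.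

Import Order.TTheory GRing.Theory Num.Theory.
Import numFieldNormedType.Exports.

(** If s is nabla^E-parallel along gamma, then its nabla^{g,E}-derivative is - 1/2 theta(gamma')
    omega s; the derivative of exp (h B) contributes exactly the opposite term, which is why h has
    to be a primitive of 1/2 theta. Around a loop on which theta has a non-zero period the two
    transports can differ by an exponential of omega: this is where the restriction to
    null-homotopic loops enters. The converse asks for omega to be nabla^{g,E}-parallel as well. It
    is, because the two derivatives of omega differ by the commutator of omega with a multiple of
    itself.

    The bundle E is never formed. Its sections are lifts to p^perp, given in charts, and an equality
    in E is a difference lying in the line of p. As E is definite, such a membership follows from
    the vanishing of a norm, and norms are easily followed along a curve. Curves, frames and h are
    controlled on closed pieces only, so C^1 extensions past the break points have to be carried
    along. *)

Section Calculus.
Local Open Scope classical_set_scope.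
Local Open Scope ring_scope.
Context {R : realType}.

(** * Calculus of matrix-valued functions, and C^1 functions on segments *)

Lemma is_derive_mxP (V : normedModType R) m n (M : V -> 'M[R]_(m, n)) t v dM :
  is_derive t v M dM <-> forall i j, is_derive t v (fun x => M x i j) (dM i j).
Proof.
split=> [[dM1 <-] i j|H].
  apply: DeriveDef; first by move/derivable_mxP: dM1.
  by rewrite derive_mx// mxE.
have dM1 : derivable M t v by apply/derivable_mxP => i j; have [] := H i j.
apply: DeriveDef => //; rewrite derive_mx//; apply/matrixP => i j.
by rewrite mxE derive_val.
Qed.

Lemma is_derive_mulmx (V : normedModType R) m n k
    (M : V -> 'M[R]_(m, n)) (N : V -> 'M[R]_(n, k)) t v dM dN :
  is_derive t v M dM -> is_derive t v N dN ->
  is_derive t v (fun x => M x *m N x) (dM *m N t + M t *m dN).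
Proof.
move=> /is_derive_mxP HM /is_derive_mxP HN; apply/is_derive_mxP => i j.
rewrite (_ : (fun x => _) =
    \sum_l ((fun x => M x i l) * (fun x => N x l j))); last first.
  by apply/funext => x; rewrite mxE fct_sumE.
have -> : (dM *m N t + M t *m dN) i j =
    \sum_l (M t i l *: dN l j + N t l j *: dM i l).
  rewrite !mxE -big_split/=; apply: eq_bigr => l _.
  by rewrite /GRing.scale/= addrC [dM _ _ * _]mulrC.
by apply: is_derive_sum => l; exact: is_deriveM.
Qed.

Lemma is_derive_trmx (V : normedModType R) m n (M : V -> 'M[R]_(m, n)) t v dM :
  is_derive t v M dM -> is_derive t v (fun x => (M x)^T) dM^T.
Proof.
move=> /is_derive_mxP HM; apply/is_derive_mxP => i j; rewrite mxE.
by rewrite (_ : (fun x => _) = (fun x => M x j i))//; apply/funext=> x; rewrite mxE.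
Qed.

Lemma is_derive_comp_diff (V W : normedModType R) (f : V -> W) (a : R -> V) t da :
  differentiable f (a t) -> is_derive t 1 a da ->
  is_derive t 1 (f \o a) ('d f (a t) da).
Proof.
move=> df [/derivable1_diffP dat dae].
have dfa : differentiable (f \o a) t by exact: differentiable_comp.
apply: DeriveDef; first exact/derivable1_diffP.
by rewrite deriveE// diff_comp//= -dae deriveE.
Qed.

Lemma is_derive_scale_comp m n (P : R -> 'M[R]_(m, n)) (h : R -> R) t dP dh :
  is_derive (h t) 1 P dP -> is_derive t 1 h dh ->
  is_derive t 1 (P \o h) (dh *: dP).
Proof.
move=> /is_derive_mxP HP Hh; apply/is_derive_mxP => i j; rewrite mxE mulrC.
exact: (@is_derive1_comp _ (fun x => P x i j) h).
Qed.

Lemma is_derive_lineP (V W : normedModType R) (f : V -> W) u v df :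
  is_derive u v f df <-> is_derive (0 : R) 1 (fun h : R => f (h *: v + u)) df.
Proof.
have E : 'D_v f u = 'D_1 (fun h : R => f (h *: v + u)) 0.
  rewrite /derive; set g1 := fun h => _; set g2 := fun h => _.
  suff -> : g1 = g2 by [].
  apply/funext => h; rewrite /g1 /g2/= addr0 scale0r add0r.
  by rewrite [_%:A]mulr1.
split=> -[d e].
  by apply: DeriveDef; [exact: (derivable1P f u v).1 d|rewrite -e E].
by apply: DeriveDef; [exact: (derivable1P f u v).2 d|rewrite -e -E].
Qed.

Lemma cvg_mxP (S : Type) (F : set_system S) {FF : Filter F} m n
    (f : S -> 'M[R]_(m, n)) (l : 'M[R]_(m, n)) :
  f @ F --> l <-> forall i j, f x i j @[x --> F] --> l i j.
Proof.
split=> [fl i j|fl].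
  exact: (cvg_comp _ _ fl (@coord_continuous R m n i j l)).
apply/cvgrPdist_le => e e0; near=> x.
rewrite /Num.Def.normr/= mx_normrE (bigmax_le _ (ltW e0))//= => i _.
rewrite !mxE/=; move: i; near: x; apply: filter_forall => /= i.
exact: ((cvgrPdist_le _ _).1 (fl i.1 i.2)).
Unshelve. all: by end_near. Qed.

Lemma continuous_mxP (S : topologicalType) m n (f : S -> 'M[R]_(m, n)) (x : S) :
  {for x, continuous f} <-> forall i j, {for x, continuous (fun y => f y i j)}.
Proof. exact: (@cvg_mxP S (nbhs x)). Qed.

Lemma near_eq_continuous (S T : topologicalType) (f g : S -> T) (x : S) :
  (\forall y \near x, f y = g y) -> {for x, continuous f} ->
  {for x, continuous g}.
Proof.
move=> fg fc; rewrite /prop_for /continuous_at -(nbhs_singleton fg).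
by apply: cvg_trans fc; exact: near_eq_cvg.
Qed.

Lemma cvg_mulmx (S : Type) (F : set_system S) {FF : Filter F} m n k
    (f : S -> 'M[R]_(m, n)) (g : S -> 'M[R]_(n, k)) (a : 'M[R]_(m, n)) (b : 'M[R]_(n, k)) :
  f @ F --> a -> g @ F --> b -> (fun x => f x *m g x) @ F --> a *m b.
Proof.
move=> /cvg_mxP fa /cvg_mxP gb; apply/cvg_mxP => i j; rewrite mxE.
rewrite (_ : (fun x => _) = (fun x => \sum_l f x i l * g x l j)); last first.
  by apply/funext => x; rewrite mxE.
apply: cvg_big => [|l _]; first exact: add_continuous.
exact: cvgM.
Qed.

Lemma continuous_mulmx (S : topologicalType) m n k
    (f : S -> 'M[R]_(m, n)) (g : S -> 'M[R]_(n, k)) (x : S) :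
  {for x, continuous f} -> {for x, continuous g} ->
  {for x, continuous (fun y => f y *m g y)}.
Proof. exact: cvg_mulmx. Qed.

(** Any function that is a derivative near [t] may serve as witness; it then equals [derive1 f] near
    every nearby point, so continuity passes over. *)
Lemma C1_atP (W : normedModType R) (f : R -> W) t :
  C1_at f t <-> exists df : R -> W,
    \forall s \near t, is_derive (s : R) 1 f (df s) /\ {for s, continuous df}.
Proof.
split=> [H|[df H]].
  exists (derive1 f); near=> s.
  have [d c] : derivable f s 1 /\ {for s, continuous (derive1 f)} by near: s.
  by split => //; apply: DeriveDef => //; rewrite derive1E.
have /near_join H2 := H.
near=> s.
have [d c] : is_derive s 1 f (df s) /\ {for s, continuous df} by near: s.
have Hs : \forall r \near s, is_derive (r : R) 1 f (df r) /\ {for r, continuous df}.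
  by near: s.
split; first exact: ex_derive.
have E : \forall r \near s, df r = derive1 f r.
  by near=> r; rewrite derive1E; apply/esym/derive_val;
    have [] : is_derive r 1 f (df r) /\ {for r, continuous df} by near: r.
rewrite /prop_for /continuous_at -(nbhs_singleton E).
by apply: cvg_trans c; apply: near_eq_cvg.
Unshelve. all: by end_near. Qed.

Lemma C1_at_derivable (W : normedModType R) (f : R -> W) t :
  C1_at f t -> is_derive t 1 f (derive1 f t).
Proof.
by move=> /nbhs_singleton[d _]; apply: DeriveDef => //; rewrite derive1E.
Qed.

Lemma C1_at_near_eq (W : normedModType R) (f g : R -> W) t :
  (\forall s \near t, f s = g s) -> C1_at f t -> C1_at g t.
Proof.
move=> /near_join fg /C1_atP[df H]; apply/C1_atP; exists df; near=> s.
have [d c] : is_derive s 1 f (df s) /\ {for s, continuous df} by near: s.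
split=> //; apply: near_eq_is_derive d; near: s; exact: fg.
Unshelve. all: by end_near. Qed.

Lemma C1_at_mxP m n (f : R -> 'M[R]_(m, n)) t :
  C1_at f t <-> forall i j, C1_at (fun s => f s i j) t.
Proof.
split=> [/C1_atP[df H] i j|H].
  apply/C1_atP; exists (fun s => df s i j); near=> s.
  have [/is_derive_mxP d /cvg_mxP c] :
    is_derive s 1 f (df s) /\ {for s, continuous df} by near: s.
  by split; [exact: d|exact: c].
have {}H i j := (C1_atP _ _).1 (H i j).
pose d i j := projT1 (cid (H i j)).
have dP i j := projT2 (cid (H i j)).
apply/C1_atP; exists (fun s => \matrix_(i, j) d i j s); near=> s.
have K i j : is_derive s 1 (fun x => f x i j) (d i j s) /\
    {for s, continuous (d i j)}.
  suff : forall p : 'I_m * 'I_n, is_derive s 1 (fun x => f x p.1 p.2) (d p.1 p.2 s) /\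
    {for s, continuous (d p.1 p.2)} by move/(_ (i, j)).
  near: s; apply: filter_forall => -[k l]; exact: dP.
split; first by apply/is_derive_mxP => i j; rewrite mxE; exact: (K i j).1.
apply/cvg_mxP => i j; rewrite mxE.
rewrite (_ : (fun x => _) = d i j); last by apply/funext => x; rewrite mxE.
exact: (K i j).2.
Unshelve. all: by end_near. Qed.

Lemma C1_at_mulmx m n k (M : R -> 'M[R]_(m, n)) (N : R -> 'M[R]_(n, k)) t :
  C1_at M t -> C1_at N t -> C1_at (fun s => M s *m N s) t.
Proof.
move=> /C1_atP[dM HM] /C1_atP[dN HN]; apply/C1_atP.
exists (fun s => dM s *m N s + M s *m dN s); near=> s.
have [d1 c1] : is_derive s 1 M (dM s) /\ {for s, continuous dM} by near: s.
have [d2 c2] : is_derive s 1 N (dN s) /\ {for s, continuous dN} by near: s.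
split; first exact: is_derive_mulmx.
have cM : {for s, continuous M}.
  exact/differentiable_continuous/derivable1_diffP/ex_derive.
have cN : {for s, continuous N}.
  exact/differentiable_continuous/derivable1_diffP/ex_derive.
by apply: cvgD; exact: cvg_mulmx.
Unshelve. all: by end_near. Qed.

(** Only the comparison function [g], which may depend on [t], has to be derivable. This
    accommodates functions known on a closed segment alone and computed in a chart that changes with
    [t]. *)
Lemma near_derive0_cst (f : R -> R) (a b : R) :
  (forall t : R, a <= t <= b -> exists g : R -> R, is_derive t 1 g 0 /\
     \forall s \near t, a <= s <= b -> f s = g s) ->
  forall t : R, a <= t <= b -> f t = f a.
Proof.
move=> H t /andP[at_ tb]; move: at_; rewrite le_eqVlt => /predU1P[->//|at_].
have sub s : a <= s <= t -> a <= s <= b.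
  by move=> /andP[-> /=] /le_trans; exact.
have [s sI||c _] := @MVT _ f (cst 0) a t at_; last first.
- by rewrite mul0r => /eqP; rewrite subr_eq0 => /eqP.
- apply/subspace_continuousP => s /=; rewrite in_itv/= => /sub sab.
  have [g [dg gE]] := H _ sab.
  have cg : {for s, continuous g}.
    exact/differentiable_continuous/derivable1_diffP/ex_derive.
  rewrite /from_subspace/=; have -> : f s = g s by exact: (nbhs_singleton gE sab).
  have : g @ within `[a, t] (nbhs s) --> g s.
    by apply: cvg_trans cg; apply: cvg_app; exact: cvg_within.
  apply: cvg_trans; apply: near_eq_cvg.
  near=> r; have atr : `[a, t]%classic r.
    by near: r; apply: withinT.
  have rab : a <= r <= b by apply: sub; move: atr; rewrite /= in_itv.
  by apply/esym; move: rab; near: r; apply: cvg_within; exact: gE.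
- move: sI; rewrite in_itv/= => /andP[as_ st].
  have sab : a <= s <= b by apply: sub; rewrite !ltW.
  have [g [dg gE]] := H _ sab.
  apply: near_eq_is_derive dg; near=> r; apply/esym.
  have : a <= r <= b -> f r = g r by near: r.
  apply; apply: sub; apply/andP; split; apply: ltW.
    by near: r; exact: lt_nbhsr.
  by near: r; exact: lt_nbhsl.
Unshelve. all: by end_near. Qed.

(** A derivative is also a one-sided derivative, and at each point of a non-degenerate segment one
    of the two sides stays inside. *)
Lemma derive1_eq_on_segment (W : normedModType R) (f g : R -> W) a b t :
  a < b -> a <= t <= b -> derivable f t 1 -> derivable g t 1 ->
  (forall s, a <= s <= b -> f s = g s) -> derive1 f t = derive1 g t.
Proof.
move=> ab /andP[at_ tb] df dg fg.
have fgt : f t = g t by apply: fg; rewrite at_ tb.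
have [tb'|bt] := ltP t b.
  have E u : derivable u t 1 -> derive1 u t =
     lim (h^-1 *: ((u \o shift t) (h *: 1) - u t) @[h --> 0^'+]) :> W.
    by move=> du; rewrite derive1E; exact: cvg_at_rightE.
  rewrite !E//; congr (lim _).
  by rewrite eqEsubset; split; apply: near_eq_cvg; near=> h; rewrite fgt /= [_%:A]mulr1 fg//;
    (apply/andP; split; [rewrite -[a]add0r lerD// | rewrite -lerBrDr; near: h;
      apply: nbhs_right_le; rewrite subr_gt0]).
have {bt}tE : t = b by apply/eqP; rewrite eq_le tb bt.
have E u : derivable u t 1 -> derive1 u t =
   lim (h^-1 *: ((u \o shift t) (h *: 1) - u t) @[h --> 0^'-]) :> W.
  by move=> du; rewrite derive1E; exact: cvg_at_leftE.
rewrite !E//; congr (lim _).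
by rewrite eqEsubset; split; apply: near_eq_cvg; near=> h; rewrite fgt /= [_%:A]mulr1 fg//;
  (apply/andP; split; [rewrite -lerBlDr; near: h;
      apply: nbhs_left_ge; rewrite subr_lt0 tE | rewrite tE gerDr]).
Unshelve. all: by end_near. Qed.

(** [psi t] is a local extension of [h] around [t]. The common extension follows [psi a] before [a]
    and [psi b] after [b]; near an interior point it is [h], hence [psi t]. *)
Lemma C1_extend (h : R -> R) (psi : R -> R -> R) a b : a < b ->
  (forall t, a <= t <= b ->
     \forall s \near t, a <= s <= b -> h s = psi t s) ->
  exists h' : R -> R, forall t, a <= t <= b ->
    h' t = h t /\ \forall s \near t, psi t s = h' s.
Proof.
move=> ab H.
exists (fun s => if s < a then psi a s else if b < s then psi b s else h s).
move=> t /andP[at_ tb]; split; first by rewrite ltNge at_/= ltNge tb.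
have E := H t (introT andP (conj at_ tb)).
move: at_; rewrite le_eqVlt => /predU1P[tE|at_].
  near=> s; case: ltP => [sa|as_]; first by rewrite tE.
  have sb : s < b by near: s; apply: lt_nbhsl; rewrite -tE.
  rewrite ltNge (ltW sb)/=; apply/esym; have : a <= s <= b -> h s = psi t s.
    by near: s.
  by apply; rewrite as_ ltW.
move: tb; rewrite le_eqVlt => /predU1P[tE|tb].
  near=> s; have as_ : a < s by near: s; exact: lt_nbhsr.
  rewrite ltNge (ltW as_)/=; case: ltP => [|sb]; first by rewrite tE.
  apply/esym; have : a <= s <= b -> h s = psi t s by near: s.
  by apply; rewrite sb ltW.
near=> s; have as_ : a < s by near: s; exact: lt_nbhsr.
have sb : s < b by near: s; apply: lt_nbhsl.
rewrite ltNge (ltW as_)/= ltNge (ltW sb)/=.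
apply/esym; have : a <= s <= b -> h s = psi t s by near: s.
by apply; rewrite !ltW.
Unshelve. all: by end_near. Qed.

End Calculus.

(** * The exponential flow of a matrix *)

Section MatrixExponential.
Local Open Scope classical_set_scope.
Local Open Scope ring_scope.
Context {R : realType}.

(** Domination by the coefficients of C exp (K x): it yields convergence on the whole line and
    survives termwise differentiation. *)
Definition exp_bounded (C K : R) (c : nat -> R) :=
  forall k, `|c k| <= C * (K ^+ k / k`!%:R).

Lemma exp_bounded_pseries_diffs (C K : R) (c : nat -> R) :
  exp_bounded C K c -> exp_bounded (C * K) K (pseries_diffs c).
Proof.
move=> H k; rewrite /pseries_diffs normrM normr_nat.
apply: (@le_trans _ _ (k.+1%:R * (C * (K ^+ k.+1 / (k.+1)`!%:R)))).
  by rewrite ler_wpM2l.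
rewrite factS natrM invfM exprS le_eqVlt; apply/orP; left; apply/eqP.
have : k.+1%:R != 0 :> R by rewrite pnatr_eq0.
have : k`!%:R != 0 :> R by rewrite pnatr_eq0 -lt0n fact_gt0.
by move=> *; field; rewrite nat1r; apply/andP.
Qed.

Lemma exp_bounded_cvg (C K : R) (c : nat -> R) x : 0 <= K ->
  exp_bounded C K c -> cvgn (pseries c x).
Proof.
move=> K0 H; apply: normed_cvg.
have C0 : 0 <= C by have := H 0; rewrite expr0 fact0 divr1 mulr1; apply: le_trans.
apply: (@series_le_cvg _ _ (fun k => C * exp_coeff (K * `|x|) k)).
- by move=> n /=.
- by move=> n; rewrite mulr_ge0// /exp_coeff/= divr_ge0// exprn_ge0// mulr_ge0.
- move=> n /=; rewrite normrM normrX /exp_coeff/= exprMn.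
  rewrite mulrAC mulrA ler_wpM2r ?exprn_ge0//; exact: H.
- rewrite (_ : series _ = (fun n => C *: series (exp_coeff (K * `|x|)) n)).
    by apply: is_cvgZr; exact: is_cvg_series_exp_coeff.
  by apply/funext => n; rewrite /series/= -mulr_sumr.
Qed.

(** [P t] is exp (t B), built entry by entry as a power series; the flow equation and the initial
    value are what later arguments use. *)
Lemma mx_exp_exists m (B : 'M[R]_m) : exists P : R -> 'M[R]_m,
  P 0 = 1%:M /\ forall t : R, is_derive t 1 P (P t *m B).
Proof.
pose c i j k : R := (k`!%:R)^-1 * (B ^+ k) i j.
(* The factor [m] makes up for the maximum norm not being submultiplicative. *)
pose K : R := m%:R * `|B|.
have K0 : 0 <= K by rewrite mulr_ge0.
have BK k i j : `|(B ^+ k) i j| <= K ^+ k.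
  elim: k i j => [|k IH] i j.
    by rewrite !expr0 mxE; case: (i == j); rewrite ?normr1// normr0.
  rewrite exprSr mxE (le_trans (ler_norm_sum _ _ _))//.
  rewrite exprSr {2}/K mulrCA mulr_natl -[X in _ *+ X]card_ord -sumr_const.
  apply: ler_sum => l _; rewrite normrM ler_pM//.
  by rewrite [leRHS]/Num.Def.normr/= mx_normrE (le_bigmax _ _ (l, j)).
have cK i j : exp_bounded 1 K (c i j).
  move=> k; rewrite mul1r /c normrM mulrC ler_pM//.
  by rewrite ger0_norm ?invr_ge0.
have cv i j x : cvgn (pseries (c i j) x) by exact: exp_bounded_cvg (cK i j).
(* Differentiating exp (t B) termwise gives exp (t B) B, since (k+1) B^(k+1) / (k+1)! = (B^k / k!)
   B. *)
have diffE i j : pseries_diffs (c i j) = (fun k => \sum_l c i l k * B l j).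
  apply/funext => k; rewrite /pseries_diffs /c factS natrM invfM exprSr mxE.
  rewrite !mulrA mulfV ?pnatr_eq0// mul1r mulr_sumr.
  by apply: eq_bigr => l _; rewrite mulrA.
exists (fun t => \matrix_(i, j) limn (pseries (c i j) t)); split.
  apply/matrixP => i j; rewrite mxE; apply: cvg_lim => //.
  apply: cvg_near_cst; near=> n.
  have n0 : (0 < n)%N by near: n; exact: nbhs_infty_gt.
  rewrite /pseries/= /series/= -(prednK n0) big_nat_recl//= big1 ?addr0.
    by rewrite /c fact0 invr1 expr0 mul1r mulr1.
  by move=> k _; rewrite exprS mul0r mulr0.
move=> t; apply/is_derive_mxP => i j.
rewrite (_ : (fun x => _) = (fun x => limn (pseries (c i j) x))); last first.
  by apply/funext => x; rewrite mxE.
have -> : ((\matrix_(i0, j0) limn (pseries (c i0 j0) t)) *m B) i j =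
    limn (pseries (pseries_diffs (c i j)) t).
  apply/esym/cvg_lim => //.
  rewrite mxE diffE.
  have -> : pseries (fun k => \sum_l c i l k * B l j) t =
      (fun n => \sum_l pseries (c i l) t n * B l j).
    apply/funext => n; rewrite /pseries/= /series/=.
    under eq_bigr do rewrite mulr_suml.
    rewrite exchange_big/=; apply: eq_bigr => l _; rewrite mulr_suml.
    by apply: eq_bigr => k _; rewrite mulrAC.
  apply: cvg_big => [|l _]; first exact: add_continuous.
  by rewrite mxE; apply: cvgMl; exact: cv.
apply: (@pseries_snd_diffs _ (c i j) (`|t| + 1)) => //.
- exact: exp_bounded_cvg (exp_bounded_pseries_diffs (cK i j)).
- apply: exp_bounded_cvg K0 (exp_bounded_pseries_diffs
    (exp_bounded_pseries_diffs (cK i j))).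
- by rewrite [ltRHS]ger0_norm ?addr_ge0// ltrDl.
Unshelve. all: by end_near. Qed.

End MatrixExponential.

(** * Mean value theorem, and differentiability from directional derivatives *)

Section Poincare.
Local Open Scope classical_set_scope.
Local Open Scope ring_scope.
Context {R : realType}.

Definition dot n (u v : 'rV[R]_n) : R := (u *m v^T) 0 0.

Lemma mx_norm_le m n (M : 'M[R]_(m, n)) (C : R) : 0 <= C ->
  (forall i j, `|M i j| <= C) -> `|M| <= C.
Proof.
move=> C0 H; by rewrite /Num.Def.normr/= mx_normrE (bigmax_le _ C0).
Qed.

Lemma mx_entry_le m n (M : 'M[R]_(m, n)) i j : `|M i j| <= `|M|.
Proof.
by rewrite [leRHS]/Num.Def.normr/= mx_normrE (le_bigmax _ _ (i, j)).
Qed.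

Lemma mx_norm_trmx_le m n (M : 'M[R]_(m, n)) : `|M^T| <= `|M|.
Proof. by apply: mx_norm_le => // i j; rewrite mxE mx_entry_le. Qed.

Lemma mx_norm_mulmx m n k (M : 'M[R]_(m, n)) (N : 'M[R]_(n, k)) :
  `|M *m N| <= n%:R * (`|M| * `|N|).
Proof.
apply: mx_norm_le => [|i j]; first by rewrite !mulr_ge0.
rewrite mxE (le_trans (ler_norm_sum _ _ _))//.
rewrite mulr_natl -[X in _ *+ X]card_ord -sumr_const.
by apply: ler_sum => l _; rewrite normrM ler_pM// mx_entry_le.
Qed.

Lemma dot_le n (u v : 'rV[R]_n) : `|dot u v| <= n%:R * (`|u| * `|v|).
Proof.
apply: (le_trans (mx_entry_le _ _ _)); apply: (le_trans (mx_norm_mulmx _ _)).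
by rewrite ler_wpM2l// ler_wpM2l// mx_norm_trmx_le.
Qed.

Lemma is_derive_affine m n (v b : 'M[R]_(m, n)) (t : R) :
  is_derive t 1 (fun h : R => h *: v + b) v.
Proof.
apply/is_derive_mxP => i j.
rewrite (_ : (fun _ => _) = (v i j \*: id) + cst (b i j)); last first.
  by apply/funext => h; rewrite !mxE/= [in RHS]/GRing.add/= /GRing.scale/= mulrC.
by apply: is_derive_eq; rewrite addr0 /GRing.scale/= mulr1.
Qed.

Lemma is_derive_dot (V : normedModType R) n (u v : V -> 'rV[R]_n) (t : V) d du dv :
  is_derive t d u du -> is_derive t d v dv ->
  is_derive t d (fun x => dot (u x) (v x)) (dot du (v t) + dot (u t) dv).
Proof.
move=> hu hv; have := is_derive_mulmx hu (is_derive_trmx hv).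
by move=> /is_derive_mxP/(_ 0 0); rewrite mxE.
Qed.

Lemma ball_convex n (u0 a b : 'rV[R]_n) (r s : R) : 0 <= s <= 1 ->
  ball u0 r a -> ball u0 r b -> ball u0 r (s *: (b - a) + a).
Proof.
move=> /andP[s0 s1]; rewrite -!ball_normE /ball_/= => ha hb.
have -> : u0 - (s *: (b - a) + a) = (1 - s) *: (u0 - a) + s *: (u0 - b).
  by apply/matrixP => i j; rewrite !mxE; ring.
apply: (le_lt_trans (ler_normD _ _)); rewrite !normrZ.
rewrite (ger0_norm s0) ger0_norm ?subr_ge0//.
have [->|sn1] := eqVneq s 1; first by rewrite subrr mul0r add0r mul1r.
have : (1 - s) * `|u0 - a| < (1 - s) * r.
  by rewrite ltr_pM2l// subr_gt0 lt_neqAle sn1.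
have : s * `|u0 - b| <= s * r by rewrite ler_wpM2l// ltW.
by lra.
Qed.

Lemma directional_MVT n (f : 'rV[R]_n -> R) (q : 'rV[R]_n -> 'rV[R]_n)
    (u0 : 'rV[R]_n) (r : R) :
  (forall u v, ball u0 r u -> is_derive u v f (dot (q u) v)) ->
  forall a b, ball u0 r a -> ball u0 r b ->
  exists2 s : R, 0 <= s <= 1 & f b - f a = dot (q (s *: (b - a) + a)) (b - a).
Proof.
move=> H a b ha hb.
have D (s : R) : 0 <= s <= 1 ->
    is_derive s 1 (fun h : R => f (h *: (b - a) + a))
      (dot (q (s *: (b - a) + a)) (b - a)).
  move=> s01; have := H _ (b - a) (ball_convex s01 ha hb).
  move=> /is_derive_lineP.
  (* [is_derive_lineP] differentiates at 0; a shift moves the base point to [s]. *)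
  have -> : (fun h : R => f (h *: (b - a) + (s *: (b - a) + a))) =
     (fun h : R => f (h *: (b - a) + a)) \o shift s.
    by apply/funext => h /=; rewrite scalerDl addrA.
  move=> K.
  have := @is_derive1_comp _ ((fun h : R => f (h *: (b - a) + a)) \o shift s)
    (shift (- s)) s (dot (q (s *: (b - a) + a)) (b - a)) 1.
  rewrite mulr1 /= subrr => /(_ K).
  have E : ((fun h : R => f (h *: (b - a) + a)) \o shift s) \o shift (- s) =
    (fun h : R => f (h *: (b - a) + a)).
    by apply/funext => h /=; rewrite subrK.
  by rewrite E; apply; exact: is_derive_shift.
have [s sI||s sI] := @MVT_segment _ (fun h : R => f (h *: (b - a) + a))
  (fun s => dot (q (s *: (b - a) + a)) (b - a)) 0 1 ler01.
- by apply: D; move: sI; rewrite in_itv/= => /andP[/ltW-> /ltW->].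
- apply: derivable_within_continuous => s; rewrite in_itv/= => sI.
  exact/ex_derive/D.
- rewrite scale1r subrK scale0r add0r subr0 mulr1 => ->.
  by exists s => //; move: sI; rewrite in_itv.
Qed.

Lemma dot_linear n (u : 'rV[R]_n) : linear (dot u : 'rV[R]_n -> R^o).
Proof. by move=> k x y; rewrite /dot linearP/= mulmxDr -scalemxAr !mxE. Qed.

Lemma continuous_dot (S : topologicalType) n (f g : S -> 'rV[R]_n) (x : S) :
  {for x, continuous f} -> {for x, continuous g} ->
  {for x, continuous (fun y => dot (f y) (g y))}.
Proof.
move=> fc /continuous_mxP gc.
have gTc : {for x, continuous (fun y => (g y)^T)}.
  apply/continuous_mxP => i j.
  rewrite (_ : (fun _ => _) = fun y => g y j i); first exact: gc.
  by apply/funext => y; rewrite mxE.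
exact: ((continuous_mxP _ _).1 (continuous_mulmx fc gTc) 0 0).
Qed.

(** By the mean value theorem an increment of [f] is the displacement paired with [q] at an
    intermediate point; continuity of [q] makes the resulting estimate uniform in the direction. *)
Lemma directional_diff n (f : 'rV[R]_n -> R) (q : 'rV[R]_n -> 'rV[R]_n)
    (u0 : 'rV[R]_n) (r : R) :
  (forall u v, ball u0 r u -> is_derive u v f (dot (q u) v)) ->
  (forall u, ball u0 r u -> {for u, continuous q}) ->
  forall u, ball u0 r u ->
    differentiable f u /\ forall v, 'd f u v = dot (q u) v.
Proof.
move=> H qc u ur.
pose L : {linear 'rV[R]_n -> R^o} := HB.pack_for {linear 'rV[R]_n -> R^o}
  (dot (q u) : 'rV[R]_n -> R^o)
  (GRing.isLinear.Build _ _ _ _ _ (dot_linear (q u))).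
have Lc : continuous L.
  by move=> v; apply: continuous_dot; [exact: cst_continuous|exact: cvg_id].
suff E : (f : 'rV[R]_n -> R^o) \o shift u = cst (f u) + L +o_ 0 id.
  have dE := diff_unique Lc E.
  split; last by move=> v; rewrite dE.
  apply/diff_locallyP; rewrite dE; split => //; exact: E.
apply/eqaddoP => _/posnumP[e].
have n0 : 0 < n.+1%:R :> R by rewrite ltr0n.
(* The dimension is the constant of [dot_le]; [n.+1] keeps the tolerance positive in dimension 0. *)
have : \forall w \near u, ball u0 r w /\ `|q u - q w| <= e%:num / n.+1%:R.
  near=> w; split; near: w; first by exact: open_nbhs_nbhs (conj (ball_open _ _) ur).
  by apply: ((cvgrPdist_le _ _).1 (qc _ ur)); rewrite divr_gt0.
move=> /nbhs_ballP[d /= d0 dP].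
have hd0 : \forall h \near (0 : 'rV[R]_n), `|h| < d by exact: nbhs0_lt.
near=> h; rewrite /= [X in `|X|](_ : _ =
  f (h + u) - f u - dot (q u) h); last by rewrite /GRing.add/= /GRing.opp/= opprD addrA.
have hd : `|h| < d by near: h; exact: hd0.
have Bd w : `|w - u| < d -> ball u d w.
  by rewrite -ball_normE /ball_/= distrC.
have hu : ball u0 r (h + u) by apply: (dP _ _).1; apply: Bd; rewrite addrK.
have [s s01 ->] := directional_MVT H ur hu.
rewrite addrK.
have [s0 s1] := andP s01.
have [_ qq] : ball u0 r (s *: h + u) /\ `|q u - q (s *: h + u)| <= e%:num / n.+1%:R.
  apply: dP; apply: Bd; rewrite addrK normrZ (le_lt_trans _ hd)//.
  by rewrite ger0_norm// ler_piMl.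
have -> : dot (q (s *: h + u)) h - dot (q u) h = dot (q (s *: h + u) - q u) h.
  by rewrite /dot mulmxBl !mxE.
apply: (le_trans (dot_le _ _)); rewrite distrC.
apply: (@le_trans _ _ (n%:R * (e%:num / n.+1%:R * `|h|))).
  by rewrite ler_wpM2l// ler_wpM2r.
rewrite mulrA ler_wpM2r// mulrCA ler_piMr// ler_pdivrMr// mul1r ler_nat.
by [].
Unshelve. all: by end_near. Qed.

End Poincare.

(** * The Poincare lemma for 1-forms on a ball *)

Section LocalPrimitive.
Local Open Scope classical_set_scope.
Local Open Scope ring_scope.
Context {R : realType} {n : nat}.

Lemma norm_le_add1 (V : normedModType R) (a b : V) :
  `|a - b| <= 1 -> `|b| <= `|a| + 1.
Proof. by move=> ab; have := lerB_dist b a; rewrite distrC; lra. Qed.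

Lemma jacobian_entry (q : 'rV[R]_n -> 'rV[R]_n) u i j : differentiable q u ->
  ('J q u) i j = ('D_(delta_mx 0 i) q u) 0 j.
Proof. by move=> d; rewrite deriveEjacobian// -rowE [RHS]mxE. Qed.

Lemma continuous_jacobian (U : set 'rV[R]_n) (q : 'rV[R]_n -> 'rV[R]_n) u :
  open U -> C_k 1 U q -> U u -> {for u, continuous (jacobian q)}.
Proof.
move=> oU [d c] Uu; apply/continuous_mxP => i j.
apply: near_eq_continuous ((continuous_mxP _ _).1 (c i u Uu) 0 j).
apply: filterS (open_nbhs_nbhs (conj oU Uu)) => w Uw.
exact/esym/jacobian_entry/d.
Qed.

(* The primitive is the integral of the form along the radii; closedness turns
   the derivative of the integrand in the direction v at the point w of the
   radius c into the derivative along the radius of t * q(w)(v). *)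
Lemma poincare (U : set 'rV[R]_n) (q : 'rV[R]_n -> 'rV[R]_n) u0 :
  open U -> U u0 -> C_k 1 U q ->
  (forall u, U u -> ('J q u)^T = 'J q u) ->
  exists (r : R) (f : 'rV[R]_n -> R), [/\ 0 < r, ball u0 r `<=` U &
    forall u, ball u0 r u ->
      differentiable f u /\ forall v, 'd f u v = dot (q u) v].
Proof.
move=> oU Uu0 C1 sym; have [qd _] := C1.
have cq u : U u -> {for u, continuous q}.
  by move=> Uu; apply: differentiable_continuous; exact: qd.
have cJ u : U u -> {for u, continuous (jacobian q)}.
  exact: continuous_jacobian.
(* Bounds both [q] and its Jacobian near [u0], the 1 absorbing their variation; this feeds the
   domination constant [G]. *)
pose C := `|q u0| + `|'J q u0| + 1.
have C0 : 0 <= C by rewrite !addr_ge0.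
have : \forall w \near u0, [/\ U w, `|q w| <= C & `|'J q w| <= C].
  have h0 : \forall w \near u0, U w by exact: open_nbhs_nbhs (conj oU Uu0).
  have h1 := (cvgrPdist_le _ _).1 (cq _ Uu0) 1 ltr01.
  have h2 := (cvgrPdist_le _ _).1 (cJ _ Uu0) 1 ltr01.
  near=> w; split.
  - by near: w; exact: h0.
  - apply: (@le_trans _ _ (`|q u0| + 1)).
      by apply: norm_le_add1; near: w; exact: h1.
    by rewrite /C lerD2r lerDl.
  - apply: (@le_trans _ _ (`|'J q u0| + 1)).
      by apply: norm_le_add1; near: w; exact: h2.
    by rewrite /C lerD2r lerDr.
move=> /nbhs_ballP[r /= r0 rP].
pose f (u : 'rV[R]_n) : R := (\int[lebesgue_measure]_(t in `[0%R, 1%R])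
  dot (q (t *: (u - u0) + u0)) (u - u0))%R.
exists r, f; split => //; first by move=> w /rP[].
apply: (directional_diff (q := q)); last by move=> u /rP[Uu _ _]; exact: cq.
move=> a v ar; apply/is_derive_lineP.
have na : `|a - u0| < r by move: ar; rewrite -ball_normE /ball_/= distrC.
(* For |h| < dl the point a + h v stays in the ball; the added 1 covers v = 0. *)
pose dl := (r - `|a - u0|) / (`|v| + 1).
have v1 : 0 < `|v| + 1 by rewrite ltr_wpDl.
have dl0 : 0 < dl by rewrite divr_gt0// subr_gt0.
have nc (h : R) : - dl < h < dl -> `|h *: v + (a - u0)| < r.
  move=> /andP[h1 h2].
  have hh : `|h| < dl by rewrite ltr_norml h1 h2.
  apply: (le_lt_trans (ler_normD _ _)); rewrite -ltrBrDr normrZ.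
  apply: (@le_lt_trans _ _ (`|h| * (`|v| + 1))).
    by rewrite ler_wpM2l// lerDl.
  by rewrite -ltr_pdivlMr.
have inU (h t : R) : - dl < h < dl -> 0 <= t <= 1 ->
    ball u0 r (t *: (h *: v + (a - u0)) + u0).
  move=> /nc hr /andP[t0 t1]; rewrite -ball_normE /ball_/= distrC addrK.
  by rewrite normrZ ger0_norm// (le_lt_trans _ hr)// ler_piMl.
pose F (h t : R) : R :=
  dot (q (t *: (h *: v + (a - u0)) + u0)) (h *: v + (a - u0)).
pose dF (h t : R) : R :=
  dot ((t *: v) *m 'J q (t *: (h *: v + (a - u0)) + u0)) (h *: v + (a - u0))
  + dot (q (t *: (h *: v + (a - u0)) + u0)) v.
have fE : (fun h : R => f (h *: v + a)) =
    (fun h => \int[lebesgue_measure]_(t in `[0%R, 1%R]) F h t)%R.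
  by apply/funext => h; rewrite /f /F addrA.
have FD (h t : R) : - dl < h < dl -> 0 <= t <= 1 ->
    is_derive h 1 (F ^~ t) (dF h t).
  move=> hI tI; have [Uw _ _] := rP _ (inU _ _ hI tI).
  apply: is_derive_dot; last exact: is_derive_affine.
  have := @is_derive_comp_diff _ _ _ q
     (fun h => t *: (h *: v + (a - u0)) + u0) h (t *: v) (qd _ Uw).
  rewrite -deriveE; last exact: qd.
  rewrite deriveEjacobian; last exact: qd.
  apply; rewrite (_ : (fun _ => _) =
     (fun h : R => h *: (t *: v) + (t *: (a - u0) + u0))).
    exact: is_derive_affine.
  by apply/funext => k; rewrite scalerDr !scalerA mulrC addrA.
have wD (h t : R) : is_derive t 1
   (fun t : R => t *: (h *: v + (a - u0)) + u0) (h *: v + (a - u0)).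
  exact: is_derive_affine.
have wc (h t : R) : {for t, continuous (fun t : R => t *: (h *: v + (a - u0)) + u0)}.
  by apply/differentiable_continuous/derivable1_diffP; exact: ex_derive.
have I0 : - dl < 0 < dl by rewrite oppr_lt0 dl0.
have Fint (h : R) : - dl < h < dl ->
    lebesgue_measure.-integrable `[0%R, 1%R] (EFin \o F h).
  move=> hI; apply: continuous_compact_integrable; first exact: segment_compact.
  apply: derivable_within_continuous => t; rewrite in_itv/= => tI.
  have [Uw _ _] := rP _ (inU _ _ hI tI).
  have := is_derive_dot (@is_derive_comp_diff _ _ _ q _ t _ (qd _ Uw) (wD h t))
    (is_derive_cst (h *: v + (a - u0)) t 1).
  by move=> /@ex_derive.
(* Bounds [dF] uniformly in [h] and [t], and so licenses differentiation under the integral sign. *)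
pose G : R := n%:R * (n%:R * (`|v| * C) * r) + n%:R * (C * `|v|).
have Gub (h t : R) : - dl < h < dl -> 0 <= t <= 1 -> `|dF h t| <= G.
  move=> hI tI; have [_ qC JC] := rP _ (inU _ _ hI tI).
  have [t0 t1] := andP tI.
  apply: (le_trans (ler_normD _ _)); apply: lerD.
    apply: (le_trans (dot_le _ _)); rewrite ler_wpM2l// ler_pM//; last first.
      exact/ltW/nc.
    apply: (le_trans (mx_norm_mulmx _ _)); rewrite ler_wpM2l// ler_pM//.
    by rewrite normrZ ger0_norm// ler_piMl.
  by apply: (le_trans (dot_le _ _)); rewrite ler_wpM2l// ler_wpM2r.
have Gint : lebesgue_measure.-integrable `[0%R, 1%R] (EFin \o (cst G : R -> R)).
  apply: continuous_compact_integrable; first exact: segment_compact.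
  by move=> t; exact: cvg_cst.
have G0 : 0 <= G by rewrite /G !(addr_ge0, mulr_ge0)// ltW.
have I01 (t : R) : `[0%R, 1%R]%classic t -> 0 <= t <= 1 by rewrite /= in_itv.
have Idl (h : R) : `]-dl, dl[%classic h -> - dl < h < dl by rewrite /= in_itv.
have d1F (h t : R) : - dl < h < dl -> 0 <= t <= 1 -> partial1of2 F h t = dF h t.
  move=> hI tI; rewrite partial1of2E; exact: (@derive_val _ _ _ _ _ _ _ (FD h t hI tI)).
have Idl0 : `]-dl, dl[%classic (0 : R) by rewrite /= in_itv.
have derf1 (h t : R) : `]-dl, dl[%classic h -> `[0%R, 1%R]%classic t ->
    derivable (F ^~ t) h 1.
  by move=> /Idl hI /I01 tI; have [] := FD h t hI tI.
have Gub1 (h t : R) : `]-dl, dl[%classic h -> `[0%R, 1%R]%classic t ->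
    `|partial1of2 F h t| <= G.
  by move=> /Idl hI /I01 tI; rewrite d1F// Gub.
have Fint1 (h : R) : `]-dl, dl[%classic h ->
    lebesgue_measure.-integrable `[0%R, 1%R] (EFin \o F h).
  by move=> /Idl; exact: Fint.
have mI : measurable (`[0%R, 1%R]%classic : set (measurableTypeR R)).
  exact: measurable_itv.
rewrite fE; apply: DeriveDef.
  exact: (derivable_under_integral mI Idl0 Fint1 derf1 (fun=> G0) Gint Gub1).
rewrite -derive1E.
rewrite (differentiation_under_integral mI Idl0 Fint1 derf1 (fun=> G0) Gint Gub1).
transitivity (\int[lebesgue_measure]_(t in `[0%R, 1%R]) dF 0 t)%R.
  by apply: eq_Rintegral => t; rewrite inE => /I01 tI; exact: d1F.
pose w (t : R) := t *: (0 *: v + (a - u0)) + u0.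
have -> : q a = q (w 1) by rewrite /w scale0r add0r scale1r subrK.
pose Q (t : R) : R := t * dot (q (w t)) v.
have QD (t : R) : 0 <= t <= 1 -> is_derive t 1 Q (dF 0 t).
  move=> tI; have [Uw _ _] := rP _ (inU _ _ I0 tI).
  have := is_derive_dot (@is_derive_comp_diff _ _ _ q _ t _ (qd _ Uw) (wD 0 t))
    (is_derive_cst v t 1).
  rewrite -deriveE; last exact: qd.
  rewrite deriveEjacobian; last exact: qd.
  move=> D1; have D2 := is_deriveM (is_derive_id t 1) D1.
  apply: is_derive_eq.
  have dot0 u : dot u (0 : 'rV[R]_n) = 0 by rewrite /dot trmx0 mulmx0 mxE.
  rewrite /dF /cst dot0 addr0 /GRing.scale/= mulr1; congr (_ + _).
  have -> : dot ((t *: v) *m 'J q (w t)) (0 *: v + (a - u0)) =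
      t * dot (v *m 'J q (w t)) (0 *: v + (a - u0)).
    by rewrite /dot -!scalemxAl !mxE.
  have tr (M : 'M[R]_1) : M 0 0 = M^T 0 0 by rewrite mxE.
  (* Closedness: symmetry of the Jacobian exchanges [v] with the radius. *)
  by congr (_ * _); rewrite /dot tr !trmx_mul trmxK (sym _ Uw) mulmxA.
have dFc (t : R) : 0 <= t <= 1 -> {for t, continuous (dF 0)}.
  move=> tI; have [Uw _ _] := rP _ (inU _ _ I0 tI).
  have c1 : {for t, continuous (fun x => q (w x))}.
    by apply: (@continuous_comp _ _ _ w q); [exact: wc|exact: cq].
  have c2 : {for t, continuous (fun x => 'J q (w x))}.
    by apply: (@continuous_comp _ _ _ w (jacobian q)); [exact: wc|exact: cJ].
  have c3 : {for t, continuous (fun x : R => x *: v)}.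
    exact: scalel_continuous.
  have cc (b : 'rV[R]_n) : {for t, continuous (fun _ : R => b)}.
    exact: cst_continuous.
  exact: continuousD (continuous_dot (continuous_mulmx c3 c2) (cc _))
    (continuous_dot c1 (cc _)).
have := @continuous_FTC2 _ (dF 0) Q 0 1 ltr01.
have Qc (t : R) : 0 <= t <= 1 -> {for t, continuous Q}.
  move=> tI; apply/differentiable_continuous/derivable1_diffP.
  by have [] := QD _ tI.
have oo01 (t : R) : t \in `]0%R, 1%R[ -> 0 <= t <= 1.
  by rewrite in_itv/= => /andP[/ltW-> /ltW->].
rewrite /Rintegral => ->.
- by rewrite /= /Q mul1r mul0r subr0.
- apply: continuous_in_subspaceT => t; rewrite inE => /I01; exact: dFc.
- split.
  + by move=> t /oo01 tI; have [] := QD t tI.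
  + by apply: cvg_at_right_filter; apply: Qc; rewrite lexx ler01.
  + by apply: cvg_at_left_filter; apply: Qc; rewrite lexx ler01.
- move=> t /oo01 tI; rewrite derive1E; exact: (@derive_val _ _ _ _ _ _ _ (QD t tI)).
Unshelve. all: by end_near. Qed.

End LocalPrimitive.

(** * Primitives of a closed form along a continuous map of a rectangle *)

Section Rectangle.
Local Open Scope classical_set_scope.
Local Open Scope ring_scope.
Context {R : realType}.

(** Compactness of a segment as real induction: the supremum of the points [x] with [P A x] is
    attained by the local property around it, and would be passed if it were less than [B]. *)
Lemma interval_glue (P : R -> R -> Prop) (A B : R) : A <= B ->
  (forall a m b, a <= m <= b -> P a m -> P m b -> P a b) ->
  (forall x, A <= x <= B -> exists2 e, 0 < e &
     forall a b, x - e < a -> a <= x -> x <= b -> b < x + e ->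
       A <= a -> b <= B -> P a b) ->
  P A B.
Proof.
move=> AB glue loc.
pose S := [set x | A <= x <= B /\ P A x].
have SA : S A.
  split; first by rewrite lexx.
  have [|e e0 H] := loc A; first by rewrite lexx.
  by apply: H => //; lra.
have hS : has_sup S by split; [exists A|exists B => x [/andP[]]].
have sB : sup S <= B by apply: ge_sup; [exists A|move=> x [/andP[]]].
have As : A <= sup S by apply: ub_le_sup => //; exact: hS.2.
have [|e e0 H] := loc (sup S); first by rewrite As.
have [x [/andP[Ax xB] PAx] xs] := sup_adherent e0 hS.
have xS : x <= sup S by apply: ub_le_sup; [exact: hS.2|split; rewrite ?Ax].
have PAs : P A (sup S).
  by apply: (glue _ x) => //; [rewrite Ax|apply: H => //; lra].
have [sB1|Bs] := ltP (sup S) B; last by rewrite (le_anti (introT andP (conj Bs sB))).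
pose b := Num.min B (sup S + e / 2).
have sb : sup S < b by rewrite /b lt_min sB1; lra.
have bB : b <= B by rewrite /b ge_min lexx.
have be : b < sup S + e by rewrite (@le_lt_trans _ _ (sup S + e / 2))//;
  [rewrite /b ge_min lexx orbT|lra].
have : S b.
  split; first by rewrite bB andbT; lra.
  by apply: (glue _ (sup S)) => //; [rewrite As ltW|apply: H => //; lra].
move=> /(ub_le_sup hS.2); lra.
Qed.

Context {Y : topologicalType}.
(* th y y' stands for the integral of a closed 1-form from y to a nearby y'. *)
Variable th : Y -> Y -> R.
Variable H : R * R -> Y.

(** Only increments near each point are prescribed, which makes sense along a merely continuous [H],
    where no form can be pulled back. *)
Definition primitive_on (A : set (R * R)) (F : R * R -> R) :=
  forall z, A z -> \forall z' \near within A (nbhs z),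
    F z' - F z = th (H z) (H z').

Lemma primitive_path A F (s : R -> R * R) a b : primitive_on A F ->
  continuous s -> (forall t, a <= t <= b -> A (s t)) ->
  forall t : R, a <= t <= b -> \forall r \near t, a <= r <= b ->
    F (s r) - F (s t) = th (H (s t)) (H (s r)).
Proof.
move=> pF cs sA t tab.
have K : \forall z' \near s t, A z' -> F z' - F (s t) = th (H (s t)) (H z').
  exact: (pF _ (sA _ tab)).
have {}K : \forall r \near t,
    A (s r) -> F (s r) - F (s t) = th (H (s t)) (H (s r)) by exact: (cs t _ K).
near=> r => rab.
have : A (s r) -> F (s r) - F (s t) = th (H (s t)) (H (s r)) by near: r.
by apply; exact: sA.
Unshelve. all: by end_near. Qed.

(** Along [s], which covers the intersection of the pieces, the two primitives differ by a locally
    constant function, hence by one constant [k], and G + k continues F. As the pieces are closed, a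
    point outside one of them has no nearby points in it. *)
Lemma primitive_glue A B (s : R -> R * R) a b :
  closed A -> closed B -> continuous s ->
  (forall t, a <= t <= b -> A (s t) /\ B (s t)) ->
  (forall z, A z -> B z -> exists2 t, a <= t <= b & z = s t) ->
  (exists F, primitive_on A F) -> (exists F, primitive_on B F) ->
  exists F, primitive_on (A `|` B) F.
Proof.
move=> cA cB cs sAB ABs [F pF] [G pG].
have FG t : a <= t <= b -> F (s t) - G (s t) = F (s a) - G (s a).
  apply: (@near_derive0_cst _ (fun t => F (s t) - G (s t))) => {}t tab.
  exists (cst (F (s t) - G (s t))); split; first exact: is_derive_cst.
  have K1 := primitive_path pF cs (fun t h => (sAB t h).1) tab.
  have K2 := primitive_path pG cs (fun t h => (sAB t h).2) tab.
  near=> r => rab; rewrite /cst.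
  have := near K1 r _ rab; have := near K2 r _ rab.
  by move=> /(_ ltac:(done)) + /(_ ltac:(done)); lra.
pose k := F (s a) - G (s a).
have FGk z : A z -> B z -> F z = G z + k.
  by move=> Az /(ABs _ Az)[t tab ->]; rewrite /k -(FG _ tab); lra.
exists (fun z => if z \in A then F z else G z + k).
move=> z zAB.
have KA : \forall z' \near z, A z -> A z' -> F z' - F z = th (H z) (H z').
  have [Az|nAz] := pselect (A z); last by near=> z' => /nAz.
  have K : \forall z' \near z, A z' -> F z' - F z = th (H z) (H z').
    exact: (pF _ Az).
  by near=> z' => _; near: z'; exact: K.
have KB : \forall z' \near z, B z -> B z' -> G z' - G z = th (H z) (H z').
  have [Bz|nBz] := pselect (B z); last by near=> z' => /nBz.
  have K : \forall z' \near z, B z' -> G z' - G z = th (H z) (H z').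
    exact: (pG _ Bz).
  by near=> z' => _; near: z'; exact: K.
have LA : \forall z' \near z, ~ A z -> ~ A z'.
  have [Az|nAz] := pselect (A z); first by near=> z'.
  have K : \forall z' \near z, ~ A z'.
    by apply: open_nbhs_nbhs; split => //; exact: closed_openC.
  by near=> z' => _; near: z'; exact: K.
have LB : \forall z' \near z, ~ B z -> ~ B z'.
  have [Bz|nBz] := pselect (B z); first by near=> z'.
  have K : \forall z' \near z, ~ B z'.
    by apply: open_nbhs_nbhs; split => //; exact: closed_openC.
  by near=> z' => _; near: z'; exact: K.
suff : \forall z' \near z, (A `|` B) z' ->
   (if z' \in A then F z' else G z' + k) - (if z \in A then F z else G z + k)
   = th (H z) (H z') by [].
near=> z' => z'AB.
have KAz : A z -> A z' -> F z' - F z = th (H z) (H z') by near: z'; exact: KA.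
have KBz : B z -> B z' -> G z' - G z = th (H z) (H z') by near: z'; exact: KB.
have LAz : ~ A z -> ~ A z' by near: z'; exact: LA.
have LBz : ~ B z -> ~ B z' by near: z'; exact: LB.
have [zA|zA] := boolP (z \in A); have [z'A|z'A] := boolP (z' \in A).
- by apply: KAz; exact: set_mem.
- move: (set_mem zA) => Az; move/negP: z'A => z'A.
  have nAz' : ~ A z' by move=> /mem_set.
  have Bz' : B z' by case: z'AB.
  have Bz : B z by apply: contrapT => /LBz.
  by rewrite (FGk _ Az Bz) -(KBz Bz Bz'); lra.
- move/negP: zA => zA; have nAz : ~ A z by move=> /mem_set.
  by case: (LAz nAz); exact: set_mem.
- move/negP: zA => zA; move/negP: z'A => z'A.
  have nAz : ~ A z by move=> /mem_set.
  have nAz' : ~ A z' by move=> /mem_set.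
  have Bz : B z by case: zAB.
  have Bz' : B z' by case: z'AB.
  by rewrite -(KBz Bz Bz'); lra.
Unshelve. all: by end_near. Qed.

Lemma continuous_hline (a : R) : continuous (fun t : R => (t, a)).
Proof.
move=> t; apply: (@cvg_pair _ _ _ (nbhs t) (nbhs t) (nbhs a) _ _ _ id (cst a)).
  exact: cvg_id.
exact: cvg_cst.
Qed.

Lemma continuous_vline (a : R) : continuous (fun t : R => (a, t)).
Proof.
move=> t; apply: (@cvg_pair _ _ _ (nbhs t) (nbhs a) (nbhs t) _ _ _ (cst a) id).
  exact: cvg_cst.
exact: cvg_id.
Qed.

Definition rect (a b c d : R) : set (R * R) :=
  [set z | (a <= z.1 <= b) /\ (c <= z.2 <= d)].

Lemma closed_rect a b c d : closed (rect a b c d).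
Proof.
have -> : rect a b c d = (fst @^-1` `[a, b]) `&` (snd @^-1` `[c, d]).
  by apply/seteqP; split => -[x y] /=; rewrite !in_itv.
apply: closedI; apply: preimage_closed; try exact: interval_closed.
- by move=> z _; exact: cvg_fst.
- by move=> z _; exact: cvg_snd.
Qed.

(** Two local primitives of a closed form differ by a local constant. How close the third point must
    be depends on the second. *)
Hypothesis th_cocycle : forall y, \forall y' \near y, \forall y'' \near y',
  th y y'' - th y y' = th y' y''.

(** Around [z0] a primitive is given by integration from [H z0]. The set [A] is quantified after the
    neighbourhood, so that one neighbourhood serves all the rectangles inside it. *)
Lemma primitive_near (X : set (R * R)) z0 : {within X, continuous H} -> X z0 ->
  \forall z \near z0, forall A, A `<=` X -> A z ->
     \forall z' \near within A (nbhs z),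
       th (H z0) (H z') - th (H z0) (H z) = th (H z) (H z').
Proof.
move=> /subspace_continuousP cH Xz0.
have := cH _ Xz0 _ (th_cocycle (H z0)) => K.
have {}K : \forall z \near z0, X z -> \forall y'' \near H z,
   th (H z0) y'' - th (H z0) (H z) = th (H z) y'' by exact: K.
near=> z => A AX Az.
have Kz : X z -> \forall y'' \near H z,
   th (H z0) y'' - th (H z0) (H z) = th (H z) y'' by near: z; exact: K.
have := cH _ (AX _ Az) _ (Kz (AX _ Az)) => L.
have {}L : \forall z' \near z, X z' ->
   th (H z0) (H z') - th (H z0) (H z) = th (H z) (H z') by exact: L.
suff : \forall z' \near z, A z' ->
   th (H z0) (H z') - th (H z0) (H z) = th (H z) (H z') by [].
near=> z' => Az'.
have : X z' -> th (H z0) (H z') - th (H z0) (H z) = th (H z) (H z').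
  by near: z'; exact: L.
by apply; exact: AX.
Unshelve. all: by end_near. Qed.

(** Real induction twice: in the second coordinate it gives primitives on thin vertical strips, and
    in the first it joins the strips along vertical sides. *)
Lemma primitive_rect A B C D : A <= B -> C <= D ->
  {within rect A B C D, continuous H} -> exists F, primitive_on (rect A B C D) F.
Proof.
move=> AB CD cH.
pose good a b c d := A <= a -> b <= B -> C <= c -> d <= D ->
  exists F, primitive_on (rect a b c d) F.
have glue1 a m b c d : a <= m <= b ->
    good a m c d -> good m b c d -> good a b c d.
  move=> /andP[am mb] g1 g2 Aa bB Cc dD.
  have -> : rect a b c d = rect a m c d `|` rect m b c d.
    apply/seteqP; split => -[x y] /=; rewrite /rect/=.
      move=> [/andP[ax xb] cyd]; have [xm|mx] := leP x m; [left|right].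
        by split => //; apply/andP; split; lra.
      by split => //; apply/andP; split; lra.
    by move=> [] [/andP[h1 h2] h3]; split => //; apply/andP; split; lra.
  apply: (@primitive_glue _ _ (fun t => (m, t)) c d).
  - exact: closed_rect.
  - exact: closed_rect.
  - exact: continuous_vline.
  - by move=> t tcd; rewrite /rect/= !lexx am mb.
  - move=> [x y]; rewrite /rect/= => -[h1 h2] [h3 _]; exists y => //.
    by congr (_, _); lra.
  - by apply: g1 => //; lra.
  - by apply: g2 => //; lra.
have glue2 a b c m d : c <= m <= d ->
    good a b c m -> good a b m d -> good a b c d.
  move=> /andP[cm md] g1 g2 Aa bB Cc dD.
  have -> : rect a b c d = rect a b c m `|` rect a b m d.
    apply/seteqP; split => -[x y] /=; rewrite /rect/=.
      move=> [axb /andP[cy yd]]; have [ym|my] := leP y m; [left|right].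
        by split => //; apply/andP; split; lra.
      by split => //; apply/andP; split; lra.
    by move=> [] [h3 /andP[h1 h2]]; split => //; apply/andP; split; lra.
  apply: (@primitive_glue _ _ (fun t => (t, m)) a b).
  - exact: closed_rect.
  - exact: closed_rect.
  - exact: continuous_hline.
  - by move=> t tcd; rewrite /rect/= !lexx cm md.
  - move=> [x y]; rewrite /rect/= => -[h1 h2] [_ h3]; exists x => //.
    by congr (_, _); lra.
  - by apply: g1 => //; lra.
  - by apply: g2 => //; lra.
suff : good A B C D by apply.
apply: (@interval_glue (fun a b => good a b C D)) => //.
  by move=> a m b h; exact: glue1.
move=> x /andP[Ax xB].
(* [e] is the half-width of a strip around [x]; stacking two pieces takes the smaller of their
   half-widths. *)
pose Q c d := exists2 e, 0 < e & forall a b, x - e < a -> a <= x -> x <= b ->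
  b < x + e -> good a b c d.
suff [e e0 He] : Q C D by exists e => // a b *; exact: He.
apply: interval_glue => //.
  move=> c m d h [e1 e10 H1] [e2 e20 H2].
  exists (Num.min e1 e2) => [|a b h1 h2 h3 h4]; first by rewrite lt_min e10.
  have m1 : Num.min e1 e2 <= e1 by rewrite ge_min lexx.
  have m2 : Num.min e1 e2 <= e2 by rewrite ge_min lexx orbT.
  by apply: (glue2 _ _ _ m) => //; [apply: H1|apply: H2] => //; lra.
move=> y /andP[Cy yD].
have Xz : rect A B C D (x, y) by rewrite /rect/= Ax xB Cy yD.
have [[U V] /= [/nbhs_ballP[e1 /= e10 U1] /nbhs_ballP[e2 /= e20 V2]] UV] :=
  primitive_near cH Xz.
exists e2 => // c d h1 h2 h3 h4 _ _; exists e1 => // a b h5 h6 h7 h8 Aa bB Cc dD.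
exists (fun z => th (H (x, y)) (H z)) => z Rz.
apply: (UV z _ (rect a b c d)) => //.
- move: Rz; rewrite /rect/= => -[/andP[? ?] /andP[? ?]].
  split; [apply: U1|apply: V2]; rewrite -ball_normE /ball_/= ltr_norml;
  apply/andP; split; lra.
- move=> w; rewrite /rect/= => -[/andP[? ?] /andP[? ?]].
  by split; apply/andP; split; lra.
Qed.

(** Three sides of the rectangle are sent to [x], so a primitive takes the same value at both ends
    of the fourth side, which carries [gamma]. *)
Lemma loop_primitive (N : nat) (gamma : R -> Y) x :
  {within `[0, N%:R]%classic `*` `[0, 1]%classic, continuous H} ->
  (forall t : R, 0 <= t <= N%:R -> H (t, 0) = gamma t /\ H (t, 1) = x) ->
  (forall s : R, 0 <= s <= 1 -> H (0, s) = x /\ H (N%:R, s) = x) ->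
  exists h : R -> R, [/\ h 0 = 0, h N%:R = 0 & forall t : R, 0 <= t <= N%:R ->
    \forall s \near t, 0 <= s <= N%:R -> h s - h t = th (gamma t) (gamma s)].
Proof.
move=> cH H1 H2.
have N0 : 0 <= N%:R :> R by [].
have RE : `[0, N%:R]%classic `*` `[0, 1]%classic = rect 0 N%:R 0 1.
  by apply/seteqP; split => -[a b] /=; rewrite !in_itv.
have [|F pF] := primitive_rect N0 ler01; first by rewrite -RE.
(* The cocycle relation with all three points equal. *)
have thx : th x x = 0.
  by have := nbhs_singleton (nbhs_singleton (th_cocycle x)); rewrite subrr.
have cst_side (s : R -> R * R) a b : continuous s ->
    (forall t, a <= t <= b -> rect 0 N%:R 0 1 (s t)) ->
    (forall t, a <= t <= b -> H (s t) = x) ->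
    forall t, a <= t <= b -> F (s t) = F (s a).
  move=> cs sR sx.
  apply: (@near_derive0_cst _ (F \o s)) => t tab.
  exists (cst (F (s t))); split; first exact: is_derive_cst.
  near=> r => rab /=.
  have : a <= r <= b -> F (s r) - F (s t) = th (H (s t)) (H (s r)).
    by near: r; exact: (primitive_path pF cs).
  by move=> /(_ rab); rewrite !sx// thx; lra.
have i1 : 0 <= (1 : R) <= 1 by rewrite lexx ler01.
have iN : 0 <= (N%:R : R) <= N%:R by rewrite lexx N0.
have e1 : F (0, 1) = F (0, 0).
  apply: (cst_side (fun t : R => (0, t)) 0 1) => [|t ht|t ht|].
  - exact: continuous_vline.
  - by rewrite /rect/= lexx N0.
  - exact: (H2 _ ht).1.
  - by rewrite ?lexx ?ler01.
have e2 : F (N%:R, 1) = F (N%:R, 0).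
  apply: (cst_side (fun t : R => (N%:R, t)) 0 1) => [|t ht|t ht|].
  - exact: continuous_vline.
  - by rewrite /rect/= lexx N0.
  - exact: (H2 _ ht).2.
  - by rewrite ?lexx ?ler01.
have e3 : F (N%:R, 1) = F (0, 1).
  apply: (cst_side (fun t : R => (t, 1)) 0 N%:R) => [|t ht|t ht|].
  - exact: continuous_hline.
  - by rewrite /rect/= lexx ler01.
  - exact: (H1 _ ht).2.
  - by rewrite lexx N0.
exists (fun t => F (t, 0) - F (0, 0)); split.
- by rewrite subrr.
- by rewrite -e2 e3 e1 subrr.
- move=> t ht.
  have K (r : R) : 0 <= r <= N%:R -> rect 0 N%:R 0 1 (r, 0).
    by move=> hr; rewrite /rect/= lexx ler01.
  have K2 := primitive_path pF (@continuous_hline 0) K ht.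
  near=> s => hs; rewrite -(H1 _ ht).1 -(H1 _ hs).1.
  have <- : F (s, 0) - F (t, 0) = th (H (t, 0)) (H (s, 0)).
    by move: hs; near: s; exact: K2.
  by lra.
Unshelve. all: by end_near. Qed.

End Rectangle.

(** * Linear algebra of Lorentzian forms and of totally skew torsion *)

Section LorentzAlgebra.
Local Open Scope ring_scope.
Context {R : realType}.

Definition lorentz_signs n : 'rV[R]_n :=
  \row_i (if val i == 0%N then -1 else 1).

Lemma lorentz_form n (a b : 'rV[R]_n.+1) :
  (a *m diag_mx (lorentz_signs n.+1) *m b^T) 0 0 =
  - (a 0 ord0 * b 0 ord0) + \sum_(i < n) a 0 (lift ord0 i) * b 0 (lift ord0 i).
Proof.
rewrite mxE (eq_bigr (fun i => a 0 i * lorentz_signs n.+1 0 i * b 0 i)).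
  rewrite big_ord_recl !mxE/= mulrN1 mulNr; congr (_ + _).
  by apply: eq_bigr => i _; rewrite mxE/= mulr1.
by move=> i _; rewrite [b^T _ _]mxE mul_mx_diag mxE.
Qed.

(* Equality case of the Cauchy-Schwarz inequality for the spacelike parts. *)
Lemma lorentz_null_diag n (x y : 'rV[R]_n) :
  let q (a b : 'rV[R]_n) := (a *m diag_mx (lorentz_signs n) *m b^T) 0 0 in
  y != 0 -> q y y = 0 -> q y x = 0 -> q x x = 0 -> exists k, x = k *: y.
Proof.
move=> q; case: n x y @q => [|n] x y q y0.
  by move: y0; rewrite thinmx0 eqxx.
rewrite /q !lorentz_form => qyy qyx qxx.
pose a := y 0 ord0; pose b := x 0 ord0.
have [a0|a0] := eqVneq a 0.
  case/eqP: y0; apply/rowP => i; rewrite mxE.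
  have [j ->|->] := unliftP ord0 i; last exact: a0.
  move/eqP: qyy; rewrite -/a a0 mulr0 oppr0 add0r psumr_eq0.
    move=> /allP/(_ j); rewrite mem_index_enum => /(_ isT)/=.
    by rewrite mulf_eq0 orbb => /eqP.
  by move=> k _; rewrite -expr2 sqr_ge0.
exists (b / a); apply/rowP => i; rewrite mxE.
have [j ->|->] := unliftP ord0 i; last by rewrite -/a -/b divfK.
(* Expanded by means of the three null conditions, the sum is a^2 b^2 - 2 (a b)(a b) + b^2 a^2. *)
have : \sum_(i < n) (a * x 0 (lift ord0 i) - b * y 0 (lift ord0 i)) ^+ 2 = 0.
  transitivity (a ^+ 2 * \sum_(i < n) x 0 (lift ord0 i) * x 0 (lift ord0 i)
    - 2 * a * b * \sum_(i < n) y 0 (lift ord0 i) * x 0 (lift ord0 i)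
    + b ^+ 2 * \sum_(i < n) y 0 (lift ord0 i) * y 0 (lift ord0 i)).
    rewrite !mulr_sumr -sumrN -!big_split/=; apply: eq_bigr => k _.
    by ring.
  have e1 : \sum_(i < n) x 0 (lift ord0 i) * x 0 (lift ord0 i) = b * b.
    by apply/eqP; rewrite -subr_eq0 addrC qxx.
  have e2 : \sum_(i < n) y 0 (lift ord0 i) * x 0 (lift ord0 i) = a * b.
    by apply/eqP; rewrite -subr_eq0 addrC qyx.
  have e3 : \sum_(i < n) y 0 (lift ord0 i) * y 0 (lift ord0 i) = a * a.
    by apply/eqP; rewrite -subr_eq0 addrC qyy.
  by rewrite e1 e2 e3; ring.
move=> /eqP; rewrite psumr_eq0; last by move=> k _; rewrite sqr_ge0.
move=> /allP/(_ j); rewrite mem_index_enum => /(_ isT)/=.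
rewrite sqrf_eq0 subr_eq0 => /eqP e.
by apply: (mulfI a0); rewrite e mulrA mulrCA mulfV// mulr1.
Qed.

(** Definiteness of p^perp / p: for a vector orthogonal to [p], membership in the line of [p] is the
    vanishing of its norm. The basis [P] reduces this to the diagonal form. *)
Lemma lorentz_null n (g P : 'M[R]_n) (u p : 'rV[R]_n) :
  P \in unitmx -> P *m g *m P^T = diag_mx (lorentz_signs n) ->
  p != 0 -> p *m g *m p^T = 0 -> p *m g *m u^T = 0 -> u *m g *m u^T = 0 ->
  (u <= p)%MS.
Proof.
move=> Pu gP p0 pp pu uu.
have E (a b : 'rV[R]_n) : a *m g *m b^T =
   (a *m invmx P) *m diag_mx (lorentz_signs n) *m (b *m invmx P)^T.
  rewrite -gP trmx_mul !mulmxA mulmxKV// -[in RHS](mulmxA _ P^T) -trmx_mul.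
  by rewrite mulVmx// trmx1 mulmx1.
have [|||| k e] := @lorentz_null_diag n (u *m invmx P) (p *m invmx P).
- by apply: contra p0 => /eqP e; rewrite -(mulmxKV Pu p) e mul0mx.
- by rewrite -E pp mxE.
- by rewrite -E pu mxE.
- by rewrite -E uu mxE.
- by rewrite -(mulmxKV Pu u) e -scalemxAl mulmxKV// scalemx_sub.
Qed.

Lemma lorentz_unit n (g P : 'M[R]_n) :
  P \in unitmx -> P *m g *m P^T = diag_mx (lorentz_signs n) -> g \in unitmx.
Proof.
move=> Pu gP; have : diag_mx (lorentz_signs n) \in unitmx.
  rewrite unitmxE det_diag unitfE; apply/prodf_neq0 => i _.
  by rewrite mxE; case: ifP => _; rewrite ?oppr_eq0 oner_neq0.
by rewrite -gP !unitmx_mul => /andP[/andP[_ ->]].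
Qed.

(* The two skewness conditions make g(S_i e_j, e_k) invariant under cyclic
   permutations, hence totally skew. *)
Lemma skew_difference n (g : 'M[R]_n) (S : 'I_n -> 'M[R]_n) :
  g \in unitmx -> g^T = g ->
  (forall i, S i *m g + g *m (S i)^T = 0) ->
  (forall i j k, let t (i j k : 'I_n) := (S i *m g) j k - (S j *m g) i k in
     t i j k = - t i k j) ->
  forall i, S i = 2^-1 *: \matrix_(j, k) (S i j k - S j i k).
Proof.
move=> gu gT skew tsk i.
pose s i j k := (S i *m g) j k.
have s1 a b c : s a b c = - s a c b.
  have gS : g *m (S a)^T = (S a *m g)^T by rewrite trmx_mul gT.
  have := congr1 (fun X : 'M[R]_n => X b c) (skew a).
  by rewrite gS /= [LHS]mxE [X in _ + X]mxE [RHS]mxE => /eqP;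
    rewrite addr_eq0 => /eqP.
have s2 a b c : s a b c - s b a c = - (s a c b - s c a b) := tsk a b c.
suff E : S i *m g = 2^-1 *: (\matrix_(j, k) (S i j k - S j i k) *m g).
  by rewrite -[LHS](mulmxK gu) E -scalemxAl mulmxK.
apply/matrixP => j k; rewrite [RHS]mxE.
have -> : (\matrix_(j, k) (S i j k - S j i k) *m g) j k = s i j k - s j i k.
  rewrite /s !mxE -sumrB; apply: eq_bigr => l _.
  by rewrite mxE mulrBl.
rewrite -/(s i j k).
(* The goal amounts to s_ijk = - s_jik, a linear consequence of these instances. *)
have := s2 i j k; have := s1 i j k; have := s1 j i k; have := s2 j k i.
have := s1 j k i; have := s1 k i j; have := s1 k j i.
by move=> *; lra.
Qed.

End LorentzAlgebra.

(** * Calculus in charts, and local primitives of theta *)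

Section ManifoldCalculus.
Local Open Scope classical_set_scope.
Local Open Scope ring_scope.
Context {R : realType}.

Lemma differentiable_entries (V : normedModType R) a b (f : V -> 'M[R]_(a, b)) x :
  (forall i j, differentiable (fun y => f y i j) x) -> differentiable f x.
Proof.
move=> H; have -> : f = \sum_i \sum_j (fun y => f y i j *: delta_mx i j).
  apply/funext => y; rewrite fct_sumE [LHS]matrix_sum_delta.
  by apply: eq_bigr => i _; rewrite fct_sumE.
apply: differentiable_sum => i; apply: differentiable_sum => j.
exact: differentiableZl.
Qed.

Lemma differentiable_entry (V : normedModType R) a b (f : V -> 'M[R]_(a, b)) x i j :
  differentiable f x -> differentiable (fun y => f y i j) x.
Proof.
move=> df; apply: (@differentiable_comp _ _ _ _ f (fun N => N i j)) => //.
exact: differentiable_coord.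
Qed.

Lemma differentiable_mulmx (V : normedModType R) a b k
    (f : V -> 'M[R]_(a, b)) (h : V -> 'M[R]_(b, k)) x :
  differentiable f x -> differentiable h x ->
  differentiable (fun y => f y *m h y) x.
Proof.
move=> df dh; apply: differentiable_entries => i j.
have -> : (fun y => (f y *m h y) i j) =
    \sum_l ((fun y => f y i l) * (fun y => h y l j)).
  by apply/funext => y; rewrite fct_sumE mxE.
apply: differentiable_sum => l; apply: differentiableM;
  exact: differentiable_entry.
Qed.

Lemma derive_mulmx (V : normedModType R) a b k
    (f : V -> 'M[R]_(a, b)) (h : V -> 'M[R]_(b, k)) x v :
  differentiable f x -> differentiable h x ->
  'D_v (fun y => f y *m h y) x = 'D_v f x *m h x + f x *m 'D_v h x.
Proof.
move=> df dh; apply: derive_val.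
by apply: is_derive_mulmx; apply: derivableP; exact: diff_derivable.
Qed.

Lemma C_k1_mulmx n a b k (U : set 'rV[R]_n)
    (f : 'rV[R]_n -> 'M[R]_(a, b)) (h : 'rV[R]_n -> 'M[R]_(b, k)) :
  open U -> C_k 1 U f -> C_k 1 U h -> C_k 1 U (fun y => f y *m h y).
Proof.
move=> oU [df cf] [dh ch]; split=> [u Uu|i u Uu].
  by apply: differentiable_mulmx; [exact: df|exact: dh].
have c : {for u, continuous (fun y => 'D_(delta_mx 0 i) f y *m h y +
                                      f y *m 'D_(delta_mx 0 i) h y)}.
  apply: continuousD; apply: continuous_mulmx.
  - exact: cf.
  - exact/differentiable_continuous/dh.
  - exact/differentiable_continuous/df.
  - exact: ch.
apply: near_eq_continuous c.
apply: filterS (open_nbhs_nbhs (conj oU Uu)) => y Uy.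
by rewrite derive_mulmx//; [exact: df|exact: dh].
Qed.

Context {n : nat} {M : manifold R n}.
Implicit Types (c d : chart M) (x : M).
Local Notation coord := Defs.coord.

Lemma coord_image c x : dom c x -> (coord c @` dom c) (coord c x).
Proof. by move=> cx; exists x. Qed.

Lemma smooth_differentiable a b c (F : M -> 'M[R]_(a, b)) x :
  smooth_comp c F -> dom c x -> differentiable (F \o par c) (coord c x).
Proof. by move=> /(_ 1%N)[dF _] cx; apply: dF; exact: coord_image. Qed.

Lemma partial_mulmx a b k c i (F : M -> 'M[R]_(a, b)) (G : M -> 'M[R]_(b, k)) x :
  smooth_comp c F -> smooth_comp c G -> dom c x ->
  partial c i (fun y => F y *m G y) x =
  partial c i F x *m G x + F x *m partial c i G x.
Proof.
move=> sF sG cx; have dF := smooth_differentiable sF cx.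
have dG := smooth_differentiable sG cx.
by rewrite /partial (derive_mulmx _ dF dG)/= coordK.
Qed.

Lemma near_dom (g : R -> M) t c : {for t, continuous g} -> dom c (g t) ->
  \forall s \near t, dom c (g s).
Proof.
move=> gc ct; apply: (gc (dom c)).
by apply: open_nbhs_nbhs; split=> //; exact: dom_open.
Qed.

Lemma is_derive_curve a b c (F : M -> 'M[R]_(a, b)) (g : R -> M) t v :
  smooth_comp c F -> {for t, continuous g} -> dom c (g t) ->
  is_derive t 1 (coord c \o g) v ->
  is_derive t 1 (F \o g) (\sum_i v 0 i *: partial c i F (g t)).
Proof.
move=> sF gc ct dv; have dF := smooth_differentiable sF ct.
have D := is_derive_comp_diff (a := coord c \o g) dF dv.
have -> : \sum_i v 0 i *: partial c i F (g t) = 'd (F \o par c) (coord c (g t)) v.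
  rewrite {2}[v]row_sum_delta linear_sum; apply: eq_bigr => i _.
  by rewrite linearZ/= /partial deriveE.
apply: near_eq_is_derive D; apply: filterS (near_dom gc ct) => s cs /=.
by rewrite coordK.
Qed.

Lemma is_derive_change_chart c d (g : R -> M) t v :
  {for t, continuous g} -> dom c (g t) -> dom d (g t) ->
  is_derive t 1 (coord c \o g) v ->
  is_derive t 1 (coord d \o g) (v *m jac c d (g t)).
Proof.
move=> gc ct dt dv.
have [dF _] := @transition_smooth _ _ M c d 1%N.
have {}dF : differentiable (coord d \o par c) (coord c (g t)).
  by apply: dF; exists (g t).
have D := is_derive_comp_diff (a := coord c \o g) dF dv.
rewrite -deriveE// deriveEjacobian// in D.
apply: near_eq_is_derive D; apply: filterS (near_dom gc ct) => s cs /=.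
by rewrite coordK.
Qed.

Lemma is_derive_change_coord c d x (f : 'rV[R]_n -> R) v :
  dom d x -> dom c x -> differentiable f (coord d x) ->
  is_derive (coord c x) v (fun u => f (coord d (par c u)))
    ('d f (coord d x) (v *m jac c d x)).
Proof.
move=> dx cx df.
have [dF _] := @transition_smooth _ _ M c d 1%N.
have {}dF : differentiable (coord d \o par c) (coord c x) by apply: dF; exists x.
have E : (coord d \o par c) (coord c x) = coord d x by rewrite /= coordK.
have df' : differentiable f ((coord d \o par c) (coord c x)) by rewrite E.
have D0 : 'd (coord d \o par c) (coord c x) v = v *m jac c d x.
  by rewrite -(deriveE v dF); exact: deriveEjacobian dF.
have D : 'd (f \o (coord d \o par c)) (coord c x) v =
    'd f (coord d x) (v *m jac c d x).
  rewrite -D0 -E.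
  exact: (congr1 (fun L : 'rV[R]_n -> R => L v) (diff_comp dF df')).
have dc := differentiable_comp dF df'.
by rewrite -D; apply: DeriveDef; [exact: diff_derivable|rewrite (deriveE _ dc)].
Qed.

Section ClosedForm.
Variables (g : sym_form M) (p : vector_field M).

(** The components of theta, the 1-form dual to [p]. *)
Definition flat c x : 'rV[R]_n := p c x *m g c x.

Lemma flat_law c d x : dom c x -> dom d x ->
  flat c x = flat d x *m (jac c d x)^T.
Proof.
by move=> cx dx; rewrite /flat (sf_law g cx dx) (vf_law p cx dx) !mulmxA.
Qed.

(** This is d theta = 0 in coordinates. *)
Hypothesis flat_closed : forall c x, dom c x ->
  ('J (flat c \o par c) (coord c x))^T = 'J (flat c \o par c) (coord c x).

Lemma flat_C1 c : C_k 1 (coord c @` dom c) (flat c \o par c).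
Proof.
exact: (C_k1_mulmx (@coord_open _ _ M c) (vf_smooth p c 1%N) (sf_smooth g c 1%N)).
Qed.

Lemma flat_local_primitive y : exists (d : chart M) (r : R) (f : 'rV[R]_n -> R),
  [/\ dom d y, 0 < r, ball (coord d y) r `<=` coord d @` dom d &
    forall u, ball (coord d y) r u -> differentiable f u /\
      forall v, 'd f u v = dot (flat d (par d u)) v].
Proof.
have [d dy] := dom_cover y; exists d.
have [|r [f [r0 rU rf]]] :=
  poincare (@coord_open _ _ M d) (coord_image dy) (flat_C1 d).
  by move=> _ [x dx <-]; exact: flat_closed.
by exists r, f.
Qed.

(** With a primitive [f y] chosen around every [y], [th y] is its increment from [y]. Where two of
    them overlap they have the same differential, whence the cocycle relation; along a curve the
    chain rule gives theta of the velocity. *)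
Lemma flat_cocycle : exists th : M -> M -> R,
  (forall y, \forall y' \near y, \forall y'' \near y',
     th y y'' - th y y' = th y' y'') /\
  forall (ga : R -> M) t c, C1_curve_at ga t -> dom c (ga t) ->
    C1_at (fun s => th (ga t) (ga s)) t /\
    derive1 (fun s => th (ga t) (ga s)) t =
      dot (flat c (ga t)) (derive1 (coord c \o ga) t).
Proof.
have [ch /choice[ra /choice[f fP]]] := choice flat_local_primitive.
pose phi y y' := f y (coord (ch y) y').
have near_ball y z : dom (ch y) z -> ball (coord (ch y) y) (ra y) (coord (ch y) z) ->
   \forall z' \near z, dom (ch y) z' /\
     ball (coord (ch y) y) (ra y) (coord (ch y) z').
  move=> dz bz; apply: filterI.
    by apply: open_nbhs_nbhs; split => //; exact: dom_open.
  have nb : nbhs (coord (ch y) z) (ball (coord (ch y) y) (ra y)).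
    by apply: open_nbhs_nbhs; split => //; exact: ball_open.
  exact: (Defs.coord_continuous dz nb).
exists (fun y y' => phi y y' - phi y y); split.
- move=> y.
  have [dy ry by_ fy] := fP y.
  apply: filterS (near_ball y y dy (ballxx _ ry)) => z [dz bz].
  have [dz' rz bz' fz] := fP z.
  set d := ch y; set d' := ch z; set u0 := coord d z.
  have uU : (coord d @` dom d) u0 by exists z.
  (* The region of the chart [d] where the primitives chosen at [y] and at [z] are both
     available. *)
  pose V := ball (coord d y) (ra y) `&` coord d @` dom d `&`
     (fun u => dom d' (par d u) /\
       ball (coord d' z) (ra z) (coord d' (par d u))).
  have nV : \forall u \near u0, V u.
    apply: filterI; first apply: filterI.
    + by apply: open_nbhs_nbhs; split => //; exact: ball_open.
    + by apply: open_nbhs_nbhs; split => //; exact: coord_open.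
    + have K : \forall z' \near par d u0, dom d' z' /\
         ball (coord d' z) (ra z) (coord d' z').
        by rewrite /u0 coordK//; apply: near_ball => //; exact: ballxx.
      exact: (par_continuous uU K).
  move/nbhs_ballP: nV => [e /= e0 eV].
  (* The transformation law of theta makes the differential of [psi] zero; the mean value theorem
     with q = 0 then makes [psi] constant on a ball. *)
  pose psi u := f y u - f z (coord d' (par d u)).
  have D u v : ball u0 e u -> is_derive u v psi (dot (0 : 'rV[R]_n) v).
    move=> /eV[[b1 [x dx ux]] [b2 b3]].
    subst u; have px : par d (coord d x) = x := coordK dx.
    rewrite px in b2 b3.
    have [df1 df1E] := fy _ b1.
    have [df2 df2E] := fz _ b3.
    have D1 : is_derive (coord d x) v (f y) (dot (flat d x) v).
      apply: DeriveDef; first exact: diff_derivable.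
      by rewrite (deriveE _ df1) df1E px.
    have D2 := is_derive_change_coord v b2 dx df2.
    rewrite df2E (coordK b2) in D2.
    have E : dot (flat d x) v - dot (flat d' x) (v *m jac d d' x) =
        dot (0 : 'rV[R]_n) v.
      by rewrite (flat_law dx b2) /dot trmx_mul !mulmxA mul0mx [in RHS]mxE subrr.
    by rewrite -E; exact: is_deriveB D1 D2.
  have K : \forall z' \near z, dom d z' /\ ball u0 e (coord d z').
    apply: filterI; first by apply: open_nbhs_nbhs; split => //; exact: dom_open.
    have nb : nbhs (coord d z) (ball u0 e).
      by apply: open_nbhs_nbhs; split => //; [exact: ball_open|exact: ballxx].
    exact: (Defs.coord_continuous dz nb).
  apply: filterS K => z' [dz1 bz1].
  have [s _] := directional_MVT D (ballxx u0 e0) bz1.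
  rewrite /dot mul0mx mxE /psi /u0 !coordK// /phi -/d -/d'.
  by move=> E; lra.
- move=> ga t c [gc gC1] ct.
  set y := ga t; have [dy ry by_ fy] := fP y; set d := ch y.
  have dC1 := gC1 d dy.
  have /C1_atP[da HA] := dC1.
  pose F s := phi y (ga s) - phi y y.
  pose dF s := dot (flat d (par d (coord d (ga s)))) (da s).
  have nb : \forall s \near t, dom d (ga s) /\
      ball (coord d y) (ra y) (coord d (ga s)).
    exact: (gc _ (near_ball y y dy (ballxx _ ry))).
  have H : \forall s \near t, is_derive (s : R) 1 F (dF s) /\ {for s, continuous dF}.
    near=> s.
    have [ds bs] : dom d (ga s) /\ ball (coord d y) (ra y) (coord d (ga s)).
      by near: s; exact: nb.
    have [Da ca] : is_derive (s : R) 1 (coord d \o ga) (da s) /\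
       {for s, continuous da} by near: s; exact: HA.
    have [df dfE] := fy _ bs.
    split.
      have D := is_derive_comp_diff (a := coord d \o ga) df Da.
      rewrite /= dfE in D.
      have := is_deriveB D (is_derive_cst (phi y y) s 1); rewrite subr0.
      by apply.
    have cgs : {for s, continuous (coord d \o ga)}.
      exact/differentiable_continuous/derivable1_diffP/ex_derive.
    have cfl : {for (coord d \o ga) s, continuous (flat d \o par d)}.
      have [dfl _] := flat_C1 d.
      apply: differentiable_continuous; apply: dfl; exact: coord_image.
    exact: continuous_dot (continuous_comp cgs cfl) ca.
  split; first by apply/C1_atP; exists dF.
  have [DF _] := nbhs_singleton H.
  rewrite derive1E (@derive_val _ _ _ _ _ _ _ DF) /dF coordK//.
  have [Da _] := nbhs_singleton HA.
  have D2 := is_derive_change_chart gc dy ct Da.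
  rewrite derive1E (@derive_val _ _ _ _ _ _ _ D2) (flat_law dy ct).
  by rewrite /dot trmx_mul !mulmxA.
Unshelve. all: by end_near. Qed.

End ClosedForm.
End ManifoldCalculus.

(** * Tensor identities for nabla and nabla^g when T = p /\ omega *)

Section TensorFacts.
Local Open Scope classical_set_scope.
Local Open Scope ring_scope.
Context {R : realType} {n : nat} {M : manifold R n}.
Implicit Types (c d : chart M) (x : M).
Local Notation coord := Defs.coord.
Variables (g : sym_form M) (p : vector_field M) (w : bivector_field M).

(** The endomorphism omega as a matrix acting on row vectors from the right. *)
Definition Om c x : 'M[R]_n := g c x *m w c x.

Lemma mx11_eq0 (A : 'M[R]_1) : A 0 0 = 0 -> A = 0.
Proof. by move=> A0; rewrite [A]mx11_scalar A0 raddf0. Qed.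

Lemma perpP c x u : perp g p c x u <-> flat g p c x *m u^T = 0.
Proof.
by split=> [h|h]; [exact: mx11_eq0|rewrite /perp /ip -/(flat g p c x) h mxE].
Qed.

Lemma perp_rows m (S : 'M[R]_(m, n)) c x :
  flat g p c x *m S^T = 0 <-> forall i, perp g p c x (row i S).
Proof.
split=> [h i|h]; first by apply/perpP; rewrite tr_row colE mulmxA h mul0mx.
apply/trmx_inj; rewrite trmx_mul trmxK trmx0; apply/row_matrixP => i.
rewrite row0 row_mul; apply: trmx_inj; rewrite trmx_mul trmxK trmx0.
exact/perpP/h.
Qed.

Hypothesis hw : in_wedge_perp g p w.

Lemma p_Om c x : dom c x -> p c x *m Om c x = 0.
Proof. by move=> cx; rewrite mulmxA; exact: hw. Qed.

Lemma sub_p_Om m (A : 'M[R]_(m, n)) c x : dom c x -> (A <= p c x)%MS ->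
  A *m Om c x = 0.
Proof. by move=> cx /submxP[X ->]; rewrite -mulmxA p_Om// mulmx0. Qed.

Lemma w_flat c x : dom c x -> w c x *m (flat g p c x)^T = 0.
Proof.
move=> cx; apply/trmx_inj; rewrite trmx_mul trmxK trmx0 bf_skew// mulmxN.
by rewrite (hw cx) oppr0.
Qed.

Lemma perp_Om m (A : 'M[R]_(m, n)) c x : dom c x ->
  flat g p c x *m (A *m Om c x)^T = 0.
Proof.
move=> cx; apply/trmx_inj; rewrite trmx_mul trmxK trmx0 -!mulmxA w_flat//.
by rewrite !mulmx0.
Qed.

Lemma Om_law c d x : dom c x -> dom d x ->
  Om c x *m jac c d x = jac c d x *m Om d x.
Proof.
by move=> cx dx; rewrite /Om (sf_law g cx dx) (bf_law w cx dx) !mulmxA.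
Qed.

(* nabla - nabla^g = T / 2, and T(X, .) is g(p, X) omega on p^perp modulo p:
   hence the form of the difference of D1 and D2, with k = 1/2 or -1/2. *)
Definition torsion_shift (D1 D2 : connection M) (k : R) := forall c x, dom c x ->
  forall u, perp g p c x u -> forall i,
  (u *m D1 c x i - u *m D2 c x i - (k * flat g p c x 0 i) *: (u *m Om c x)
    <= p c x)%MS.

(** Parallelism of omega as an endomorphism of E: its derivative is tested on p^perp and read modulo
    p. In this form it passes from nabla to nabla^g. *)
Definition weakly_parallel (D : connection M) := forall c x, dom c x ->
  forall u, perp g p c x u -> forall i,
  (u *m g c x *m nabla_bv D w c x i <= p c x)%MS.

Variables (nabla nablag : connection M).
Hypothesis hgeom : parallel_skew_torsion_geometry g nabla.
Hypothesis hLC : levi_civita g nablag.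
Hypothesis hiso : isotropic g p.
Hypothesis hp : parallel_field nabla p.
Hypothesis hT : torsion_is_wedge g p nabla w.
Hypothesis hpar : parallel_on_screen g p nabla w.

Lemma T_delta (D : connection M) c x i u :
  T D c x (delta_mx 0 i) u = u *m tors D c x i.
Proof.
rewrite /T (bigD1 i)//= big1 ?addr0.
  by rewrite mxE !eqxx scale1r.
by move=> j ji; rewrite mxE eqxx/= (negbTE ji) scale0r.
Qed.

Lemma levi_civita_sym c x i j k : dom c x ->
  nablag c x i j k = nablag c x j i k.
Proof.
move=> cx; have := hLC.1 c x cx (delta_mx 0 i) (delta_mx 0 j).
rewrite T_delta => /rowP/(_ k); rewrite -rowE !mxE => /eqP.
by rewrite subr_eq0 => /eqP.
Qed.

Let S c x i := nabla c x i - nablag c x i.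

Lemma difference_skew c x i : dom c x ->
  S c x i *m g c x + g c x *m (S c x i)^T = 0.
Proof.
move=> cx; have [_ hm _ _] := hgeom.
have e1 := hm c x cx i; have e2 := hLC.2 c x cx i.
rewrite /S linearB/= mulmxBl mulmxBr.
rewrite -[RHS](subrr 0) -{1}e2 -e1.
move: (nabla c x i *m _) (nablag c x i *m _) (g c x *m (nabla c x i)^T).
move: (g c x *m (nablag c x i)^T) (partial _ _ _ _) => a b u v z.
by apply/matrixP => j k; rewrite !mxE; ring.
Qed.

(** The Levi-Civita symbols are symmetric, so the torsion of [nabla] is the alternation of the
    difference tensor [S] in its first two indices; total skewness recovers [S] from it. *)
Lemma difference_half_torsion c x i : dom c x ->
  S c x i = 2^-1 *: tors nabla c x i.
Proof.
move=> cx; have [hl _ _ hs] := hgeom.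
have [P Pu gP] := hl c x cx.
rewrite (@skew_difference _ _ (g c x) (S c x)).
- congr (_ *: _); apply/matrixP => j k; rewrite !mxE levi_civita_sym//.
  by ring.
- exact: lorentz_unit Pu gP.
- exact: sf_sym.
- by move=> j; exact: difference_skew.
- move=> {}i j k t.
  have tE a b e : t a b e =
      ip g c x (T nabla c x (delta_mx 0 a) (delta_mx 0 b)) (delta_mx 0 e).
    rewrite T_delta /ip -[X in (X *m _) 0 0]mulmxA -rowE trmx_delta -colE.
    rewrite [RHS]mxE [RHS]mxE.
    rewrite /t !mxE -sumrB; apply: eq_bigr => l _; rewrite !mxE.
    by rewrite levi_civita_sym//; ring.
  by rewrite !tE; exact: (hs c x cx _ _ _).2.
Qed.

(** On p^perp the term of T with the factor g(p, u) drops out, and the term along [p] is absorbed in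
    [b]. *)
Lemma perp_torsion c x i u : dom c x -> perp g p c x u ->
  exists b, u *m tors nabla c x i =
    flat g p c x 0 i *: (u *m Om c x) + b *: p c x.
Proof.
move=> cx pu; exists (bv_form g w c x (delta_mx 0 i) u).
rewrite -T_delta (hT cx) (_ : ip g c x (p c x) u = 0)// scale0r subr0.
rewrite {1}/ip -/(flat g p c x) trmx_delta -colE mxE.
by rewrite /bv_end mulmxA.
Qed.

Lemma perp_difference c x i u : dom c x -> perp g p c x u ->
  exists b, u *m nabla c x i - u *m nablag c x i =
    (2^-1 * flat g p c x 0 i) *: (u *m Om c x) + b *: p c x.
Proof.
move=> cx pu; have [b bE] := perp_torsion i cx pu; exists (2^-1 * b).
rewrite -mulmxBr -/(S c x i) difference_half_torsion// -scalemxAr bE.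
by rewrite scalerDr !scalerA.
Qed.

Lemma torsion_shift_nabla : torsion_shift nabla nablag 2^-1.
Proof.
move=> c x cx u pu i; have [b ->] := perp_difference i cx pu.
by rewrite addrAC subrr add0r scalemx_sub.
Qed.

Lemma torsion_shift_nablag : torsion_shift nablag nabla (- 2^-1).
Proof.
move=> c x cx u pu i; have [b bE] := perp_difference i cx pu.
rewrite -[u *m nablag c x i - _]opprB bE mulNr scaleNr opprK addrC opprD addrA.
by rewrite subrr add0r eqmx_opp scalemx_sub.
Qed.

Lemma weakly_parallel_nabla : weakly_parallel nabla.
Proof.
move=> c x cx u pu i; have [a pa ->] := hpar cx i.
rewrite mulmxBr !mulmxA.
have -> : u *m g c x *m (p c x)^T = 0.
  apply: trmx_inj; rewrite !trmx_mul trmxK sf_sym// mulmxA trmx0.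
  exact/perpP.
by rewrite mul0mx sub0r eqmx_opp submxMl.
Qed.

(** The two derivatives of omega differ by the commutator of [S_i] with omega; on p^perp modulo p,
    [S_i] is a multiple of omega, so the commutator vanishes there. *)
Lemma weakly_parallel_nablag : weakly_parallel nablag.
Proof.
move=> c x cx u pu i.
have K := weakly_parallel_nabla cx pu i.
have -> : nabla_bv nablag w c x i =
    nabla_bv nabla w c x i - ((S c x i)^T *m w c x + w c x *m S c x i).
  rewrite /nabla_bv /S linearB/= mulmxBl mulmxBr.
  move: (_^T *m _) (_^T *m _) (w c x *m _) (w c x *m _) (partial _ _ _ _).
  by move=> a1 a2 a3 a4 a5; apply/matrixP => j k; rewrite !mxE; ring.
rewrite mulmxBr (addmx_sub K)// eqmx_opp mulmxDr !mulmxA.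
have -> : u *m g c x *m (S c x i)^T = - (u *m S c x i *m g c x).
  apply/eqP; rewrite -addr_eq0 -!mulmxA -mulmxDr addrC.
  by rewrite difference_skew// mulmx0.
have [b bE] := perp_difference i cx pu.
have pO : perp g p c x (u *m Om c x) by apply/perpP; exact: perp_Om.
have [b' bE'] := perp_difference i cx pO.
rewrite -[u *m g c x *m w c x]mulmxA -/(Om c x) [u *m Om c x *m _]mulmxBr bE'.
rewrite mulNmx -[_ *m g c x *m w c x]mulmxA -/(Om c x) mulmxBr bE mulmxDl.
rewrite -!scalemxAl p_Om// scaler0 addr0 addrA addNr add0r.
by rewrite scalemx_sub.
Qed.

(** T(X, p) = 0 for every X: [p] is isotropic and the lift of omega annihilates it, which kills all
    three terms. *)
Lemma parallel_nablag : parallel_field nablag p.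
Proof.
move=> c x cx i; have [px pp] := hiso cx.
have [b bE] := perp_difference i cx pp.
have E : p c x *m tors nabla c x i = 0.
  rewrite -T_delta (hT cx) pp scale0r subr0 /bv_end -[p c x *m _ *m _]mulmxA.
  rewrite -/(Om c x) p_Om// scaler0 add0r /bv_form /ip /bv_end.
  rewrite -2!mulmxA.
  have -> : w c x *m (g c x *m (p c x)^T) = 0.
    by rewrite -(sf_sym g cx) -trmx_mul w_flat.
  by rewrite mulmx0 mxE scale0r.
have D : p c x *m nabla c x i = p c x *m nablag c x i.
  apply/eqP; rewrite -subr_eq0 -mulmxBr -/(S c x i) difference_half_torsion//.
  by rewrite -scalemxAr E scaler0.
by rewrite -D; exact: hp.
Qed.

(** Since theta is nabla^g-parallel, the derivative of theta_j along d_i is theta of the Levi-Civita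
    derivative of d_j along d_i, which is symmetric in i and j. *)
Lemma flat_closed c x : dom c x ->
  ('J (flat g p c \o par c) (coord c x))^T = 'J (flat g p c \o par c) (coord c x).
Proof.
move=> cx.
have [df _] := flat_C1 g p c.
have {}df := df _ (coord_image cx).
have E i : 'D_(delta_mx 0 i) (flat g p c \o par c) (coord c x) =
    flat g p c x *m (nablag c x i)^T.
  have := partial_mulmx i (vf_smooth p c) (sf_smooth g c) cx.
  rewrite /partial => ->.
  rewrite -/(partial c i (p c) x) -/(partial c i (g c) x).
  have -> : partial c i (p c) x = - (p c x *m nablag c x i).
    by apply/eqP; rewrite -addr_eq0; apply/eqP; exact: parallel_nablag.
  have -> : partial c i (g c) x =
      nablag c x i *m g c x + g c x *m (nablag c x i)^T.
    by apply/eqP; rewrite -subr_eq0 opprD addrA; apply/eqP; exact: hLC.2.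
  by rewrite mulmxDr mulNmx !mulmxA addrA addNr add0r.
apply/matrixP => i j; rewrite mxE (jacobian_entry _ _ df) (jacobian_entry _ _ df).
rewrite !E !mxE; apply: eq_bigr => k _; rewrite !mxE.
by rewrite levi_civita_sym.
Qed.

End TensorFacts.

(** * Parallel frames of the screen bundle along curves *)

Section Frames.
Local Open Scope classical_set_scope.
Local Open Scope ring_scope.
Context {R : realType} {n : nat} {M : manifold R n}.
Implicit Types (c d : chart M) (x : M).
Local Notation coord := Defs.coord.
Variables (g : sym_form M) (p : vector_field M) (w : bivector_field M).
Hypothesis hlor : lorentzian g.
Hypothesis hiso : isotropic g p.
Hypothesis hw : in_wedge_perp g p w.

Definition vel (ga : R -> M) c t : 'rV[R]_n := derive1 (coord c \o ga) t.

Definition Gam_along (D : connection M) (ga : R -> M) c t : 'M[R]_n :=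
  \sum_i vel ga c t 0 i *: D c (ga t) i.

(* The rows of S c t are the c-components of lifts to p^perp of m sections of
   E along ga. *)
Definition lift_frame m N (ga : R -> M) (S : chart M -> R -> 'M[R]_(m, n)) :=
  forall t, 0 <= t <= N%:R -> forall c, dom c (ga t) ->
    flat g p c (ga t) *m (S c t)^T = 0 /\
    forall d, dom d (ga t) -> S d t = S c t *m jac c d (ga t).

Definition C1_on_segment (k : nat) (ga ga' : R -> M) :=
  forall t, k%:R <= t <= k.+1%:R -> ga' t = ga t /\ C1_curve_at ga' t.

Definition parallel_frame_on (D : connection M) m (k : nat) (ga ga' : R -> M)
    (S S' : chart M -> R -> 'M[R]_(m, n)) :=
  forall t, k%:R <= t <= k.+1%:R -> forall c, dom c (ga t) ->
    [/\ S' c t = S c t, C1_at (S' c) t &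
        ((derive1 (S' c) t + S c t *m Gam_along D ga' c t)%R <= p c (ga t))%MS].

Lemma segment_sub (k N : nat) (t : R) : (k < N)%N ->
  k%:R <= t <= k.+1%:R -> 0 <= t <= N%:R.
Proof.
move=> kN /andP[h1 h2]; rewrite (le_trans _ h1)//= (le_trans h2)//.
by rewrite ler_nat.
Qed.

Lemma vel_eq (k : nat) (ga ga1 ga2 : R -> M) t c :
  C1_on_segment k ga ga1 -> C1_on_segment k ga ga2 ->
  k%:R <= t <= k.+1%:R -> dom c (ga t) -> vel ga1 c t = vel ga2 c t.
Proof.
move=> h1 h2 tk ct; have [e1 [_ c1]] := h1 t tk; have [e2 [_ c2]] := h2 t tk.
apply: (@derive1_eq_on_segment _ _ _ _ k%:R k.+1%:R) => //.
- by rewrite ltr_nat.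
- by have [] := C1_at_derivable (c1 c (eq_ind_r (dom c) ct e1)).
- by have [] := C1_at_derivable (c2 c (eq_ind_r (dom c) ct e2)).
- by move=> s sk; rewrite /= (h1 s sk).1 (h2 s sk).1.
Qed.

(** Each section comes with its own extension of the curve. By [vel_eq] all extensions have the same
    velocity on the segment, so the single [ga'] serves every row. *)
Lemma parallel_frame_exists (D : connection M) m N (k : nat) (ga ga' : R -> M)
    (s : 'I_m -> chart M -> R -> 'rV[R]_n) : (k < N)%N ->
  C1_on_segment k ga ga' ->
  (forall i, screen_parallel_along g p D N ga (s i)) ->
  exists S', parallel_frame_on D k ga ga' (fun c t => \matrix_i s i c t) S'.
Proof.
move=> kN hga hs.
have /choice[gs /choice[s' H]] := fun i => (hs i).2 k kN.
exists (fun c t => \matrix_i s' i c t) => t tk c ct.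
have hgs i : C1_on_segment k ga (gs i).
  by move=> r rk; have [-> ? _] := H i r rk.
split.
- apply/row_matrixP => i; rewrite !rowK.
  by have [_ _ /(_ c ct)[]] := H i t tk.
- apply/C1_at_mxP => i j.
  have [_ _ /(_ c ct)[_ /C1_at_mxP/(_ 0 j) K _]] := H i t tk.
  rewrite (_ : (fun _ => _) = (fun r => s' i c r 0 j))//.
  by apply/funext => r; rewrite mxE.
- apply/row_subP => i; have [_ _ /(_ c ct)[_ sC1]] := H i t tk.
  rewrite /Defs.eqE subr0 => K.
  rewrite linearD/= row_mul rowK.
  have -> : row i (derive1 (fun t => \matrix_i s' i c t) t) = derive1 (s' i c) t.
    have [d1 e1] := C1_at_derivable sC1.
    rewrite -e1 derive1E; apply/rowP => j; rewrite mxE.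
    have dS : is_derive t 1 (fun t => \matrix_i s' i c t)
        (\matrix_i derive1 (s' i c) t).
      apply/is_derive_mxP => i1 j1; rewrite mxE.
      have [_ _ /(_ c ct)[_ sC1' _]] := H i1 t tk.
      have /is_derive_mxP/(_ 0 j1) := C1_at_derivable sC1'.
      rewrite (_ : (fun r => (\matrix_i s' i c r) i1 j1) = (fun r => s' i1 c r 0 j1))//.
      by apply/funext => r; rewrite mxE.
    by rewrite (@derive_val _ _ _ _ _ _ _ dS) mxE derive1E.
  rewrite /Gam_along (vel_eq hga (hgs i) tk ct).
  by rewrite (hga t tk).1.
Qed.

Lemma lift_frame_rows (D : connection M) m N (ga : R -> M)
    (s : 'I_m -> chart M -> R -> 'rV[R]_n) :
  (forall i, screen_parallel_along g p D N ga (s i)) ->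
  lift_frame N ga (fun c t => \matrix_i s i c t).
Proof.
move=> hs t tN c ct; split.
  apply/perp_rows => i; rewrite rowK.
  exact: ((hs i).1 t tN c ct).1.
move=> d dt; apply/row_matrixP => i; rewrite row_mul !rowK.
exact: ((hs i).1 t tN c ct).2.
Qed.

Lemma sum_scale_mulr m k (v : 'rV[R]_n) (A : 'M[R]_(k, m)) (B : 'I_n -> 'M[R]_m) :
  A *m (\sum_i v 0 i *: B i) = \sum_i v 0 i *: (A *m B i).
Proof. by rewrite mulmx_sumr; apply: eq_bigr => i _; rewrite -scalemxAr. Qed.

Lemma is_derive_metric (D : connection M) (ga : R -> M) c t :
  metric_connection g D -> C1_curve_at ga t -> dom c (ga t) ->
  is_derive t 1 (g c \o ga)
    (Gam_along D ga c t *m g c (ga t) + g c (ga t) *m (Gam_along D ga c t)^T).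
Proof.
move=> hm [gc gC1] ct.
have := is_derive_curve (sf_smooth g c) gc ct (C1_at_derivable (gC1 c ct)).
have <- : \sum_i vel ga c t 0 i *: partial c i (g c) (ga t) =
  Gam_along D ga c t *m g c (ga t) + g c (ga t) *m (Gam_along D ga c t)^T.
  rewrite /Gam_along mulmx_suml linear_sum mulmx_sumr -big_split/=.
  apply: eq_bigr => i _; rewrite -scalemxAl linearZ/= -scalemxAr -scalerDr.
  congr (_ *: _); apply/eqP; rewrite -subr_eq0 opprD addrA; apply/eqP.
  exact: hm.
exact.
Qed.

Lemma is_derive_bivector (D : connection M) (ga : R -> M) c t :
  C1_curve_at ga t -> dom c (ga t) ->
  is_derive t 1 (w c \o ga)
    (\sum_i vel ga c t 0 i *: nabla_bv D w c (ga t) i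
     - (Gam_along D ga c t)^T *m w c (ga t) - w c (ga t) *m Gam_along D ga c t).
Proof.
move=> [gc gC1] ct.
have := is_derive_curve (bf_smooth w c) gc ct (C1_at_derivable (gC1 c ct)).
have <- : \sum_i vel ga c t 0 i *: partial c i (w c) (ga t) =
  \sum_i vel ga c t 0 i *: nabla_bv D w c (ga t) i
     - (Gam_along D ga c t)^T *m w c (ga t) - w c (ga t) *m Gam_along D ga c t.
  rewrite /Gam_along linear_sum/= mulmx_suml mulmx_sumr -!sumrB.
  apply: eq_bigr => i _; rewrite linearZ/= -scalemxAl -scalemxAr -!scalerBr.
  by rewrite /nabla_bv; congr (_ *: _); rewrite addrAC addrK addrK.
exact.
Qed.

Lemma gram_chart m c d x (U : 'M[R]_(m, n)) : dom c x -> dom d x ->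
  (U *m jac c d x) *m g d x *m (U *m jac c d x)^T = U *m g c x *m U^T.
Proof. by move=> cx dx; rewrite (sf_law g cx dx) trmx_mul !mulmxA. Qed.

(* The Gram matrix of a parallel frame is constant, and p^perp / p is
   positive definite: this replaces uniqueness of parallel transport. *)
Lemma parallel_frame_zero (D : connection M) m N (ga : R -> M)
    (U : chart M -> R -> 'M[R]_(m, n)) :
  metric_connection g D -> lift_frame N ga U ->
  (forall k, (k < N)%N -> exists ga', C1_on_segment k ga ga' /\
    exists U' : chart M -> R -> 'M[R]_(m, n),
      forall t, k%:R <= t <= k.+1%:R -> forall c, dom c (ga t) ->
      U' c t = U c t /\
      exists dU, is_derive t 1 (U' c) dU /\
        ((dU + U c t *m Gam_along D ga' c t)%R <= p c (ga t))%MS) ->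
  forall c0, dom c0 (ga 0) -> (U c0 0 <= p c0 (ga 0))%MS ->
  forall t, 0 <= t <= N%:R -> forall c, dom c (ga t) -> (U c t <= p c (ga t))%MS.
Proof.
move=> hm hU hpar c0 c00 U0.
have [ch chP] := choice (@dom_cover _ _ M).
(* The Gram matrix in a chart chosen at each point; it does not depend on the choice, so it is one
   function of [t] along the whole curve. *)
pose F t := U (ch (ga t)) t *m g (ch (ga t)) (ga t) *m (U (ch (ga t)) t)^T.
have FE t c : 0 <= t <= N%:R -> dom c (ga t) ->
    F t = U c t *m g c (ga t) *m (U c t)^T.
  move=> tN ct; rewrite /F ((hU t tN c ct).2 _ (chP _)) gram_chart//.
have step k : (k < N)%N -> forall t, k%:R <= t <= k.+1%:R -> F t = F k%:R.
  move=> kN t tk; apply/matrixP => i j.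
  have [ga' [hga [U' hU']]] := hpar k kN.
  apply: (@near_derive0_cst _ (fun t => F t i j) k%:R k.+1%:R) => // {tk}t tk.
  set c := ch (ga t).
  have [ge gC1] := hga t tk.
  have ct : dom c (ga t) by exact: chP.
  have ct' : dom c (ga' t) by rewrite ge.
  have [UE [dU [DU pU]]] := hU' t tk c ct.
  exists (fun s => (U' c s *m g c (ga' s) *m (U' c s)^T) i j); split.
    have Dg := is_derive_metric hm gC1 ct'.
    have := is_derive_mulmx (is_derive_mulmx DU Dg) (is_derive_trmx DU).
    move=> /is_derive_mxP/(_ i j).
    rewrite /= ge UE.
    set G := Gam_along D ga' c t.
    (* Metricity turns the derivative into covariant derivatives of [U]; these lie in the line of
       [p], hence are orthogonal to the rows of [U]. *)
    have -> : (dU *m g c (ga t) + U c t *m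
        (G *m g c (ga t) + g c (ga t) *m G^T)) *m (U c t)^T +
        U c t *m g c (ga t) *m dU^T =
        (dU + U c t *m G) *m g c (ga t) *m (U c t)^T +
        U c t *m g c (ga t) *m (dU + U c t *m G)^T.
      rewrite [(_ + _ *m G)^T]linearD/= trmx_mul !mulmxDl !mulmxDr !mulmxDl.
      rewrite !mulmxA.
      move: (_ *m dU^T) (_ *m (U c t)^T) (_ *m (U c t)^T) (_ *m (U c t)^T).
      by move=> a b e f; apply/matrixP => k1 k2; rewrite !mxE; ring.
    have K : (dU + U c t *m G) *m g c (ga t) *m (U c t)^T = 0.
      move/submxP: pU => [X ->]; rewrite -!mulmxA [p c _ *m _]mulmxA.
      have [-> _] := hU t (segment_sub kN tk) c ct.
      by rewrite mulmx0.
    rewrite K add0r.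
    have -> : U c t *m g c (ga t) *m (dU + U c t *m G)^T = 0.
      apply: trmx_inj; rewrite !trmx_mul trmxK trmx0 sf_sym//.
      by rewrite mulmxA.
    by rewrite mxE.
  have K := near_dom gC1.1 ct'.
  near=> s => sk.
  have cs : dom c (ga' s) by near: s; exact: K.
  have [gse _] := hga s sk; rewrite gse in cs *.
  rewrite (FE s c (segment_sub kN sk) cs).
  by rewrite (hU' s sk c cs).1.
(* Consecutive pieces share an end point, so the constants agree. *)
have Fk k : (k <= N)%N -> forall t, 0 <= t <= k%:R -> F t = F 0.
  elim: k => [_ t|k IH kN t /andP[t0 tk]].
    by rewrite -eq_le => /eqP <-.
  have [tk'|kt] := leP t k%:R; first by apply: IH; rewrite ?t0// ltnW.
  rewrite (step k kN t); last by rewrite (ltW kt) tk.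
  by apply: IH; rewrite ?lexx ?ler0n// ltnW.
have N00 : 0 <= (0 : R) <= N%:R by rewrite lexx ler0n.
have F0 : F 0 = 0.
  rewrite (FE 0 c0 N00 c00); move/submxP: U0 => [X ->].
  have [_ pp] := hiso c00; rewrite trmx_mul.
  have -> : X *m p c0 (ga 0) *m g c0 (ga 0) *m ((p c0 (ga 0))^T *m X^T) =
    X *m (p c0 (ga 0) *m g c0 (ga 0) *m (p c0 (ga 0))^T) *m X^T.
    by rewrite !mulmxA.
  by rewrite (mx11_eq0 pp) mulmx0 mul0mx.
(* Each row of [U] is orthogonal to [p] and has norm zero. *)
move=> t tN c ct; apply/row_subP => i.
have [P Pu gP] := hlor ct.
have [p0 pp] := hiso ct.
apply: (lorentz_null Pu gP p0 (mx11_eq0 pp)).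
  by rewrite -/(flat g p c (ga t)); apply/perpP; apply: (perp_rows _ _ _ _ _).1;
    exact: (hU t tN c ct).1.
have := Fk N (leqnn N) t tN; rewrite F0 (FE t c tN ct) => /matrixP/(_ i i).
rewrite [in X in _ = X]mxE => e; apply: mx11_eq0; rewrite -[RHS]e.
by rewrite -row_mul tr_row colE mulmxA -row_mul -colE [LHS]mxE [LHS]mxE.
Unshelve. all: by end_near. Qed.

End Frames.

(** * Comparison of the parallel transports around null-homotopic loops *)

Section Holonomy.
Local Open Scope classical_set_scope.
Local Open Scope ring_scope.
Context {R : realType} {n : nat} {M : manifold R n}.
Implicit Types (c d : chart M) (x : M).
Local Notation coord := Defs.coord.

Lemma C1_at_flow m (P : R -> 'M[R]_m) (B : 'M[R]_m) (h : R -> R) t :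
  (forall t : R, is_derive t 1 P (P t *m B)) -> C1_at h t -> C1_at (P \o h) t.
Proof.
move=> dP /C1_atP[dh H]; apply/C1_atP.
exists (fun s => dh s *: (P (h s) *m B)); near=> s.
have [Dh ch] : is_derive (s : R) 1 h (dh s) /\ {for s, continuous dh}.
  by near: s; exact: H.
split; first exact: is_derive_scale_comp.
have cP : {for h s, continuous P}.
  exact/differentiable_continuous/derivable1_diffP/ex_derive.
have chs : {for s, continuous h}.
  exact/differentiable_continuous/derivable1_diffP/ex_derive.
have cPh : {for s, continuous (fun s => P (h s))} := continuous_comp chs cP.
have cPB : {for s, continuous (fun s => P (h s) *m B)}.
  by apply: (continuous_mulmx cPh); exact: cst_continuous.
apply/continuous_mxP => i j.
rewrite (_ : (fun _ => _) = fun y => dh y * (P (h y) *m B) i j).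
  exact: continuousM ch ((continuous_mxP _ _).1 cPB i j).
by apply/funext => y; rewrite mxE.
Unshelve. all: by end_near. Qed.

Lemma C1_at_affine (f : R -> R) (k b : R) t :
  C1_at f t -> C1_at (fun s => k * (b + f s)) t /\
  derive1 (fun s => k * (b + f s)) t = k * derive1 f t.
Proof.
move=> /C1_atP[df H].
have E : (fun s => k * (b + f s)) = k \*: (cst b + f) by [].
have D (s dfs : R) : is_derive s 1 f dfs -> is_derive s 1 (fun s => k * (b + f s)) (k * dfs).
  move=> Df; rewrite E; have := is_deriveZ k (is_deriveD (is_derive_cst b s 1) Df).
  by rewrite add0r.
split.
  apply/C1_atP; exists (fun s => k * df s); near=> s.
  have [Df cf] : is_derive (s : R) 1 f (df s) /\ {for s, continuous df}.
    by near: s; exact: H.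
  split; first exact: D.
  by apply: (@continuousM _ _ (cst k) df) => //; exact: cst_continuous.
have [Df _] := nbhs_singleton H.
rewrite !derive1E (@derive_val _ _ _ _ _ _ _ (D _ _ Df)).
by rewrite (@derive_val _ _ _ _ _ _ _ Df).
Unshelve. all: by end_near. Qed.

Variables (g : sym_form M) (p : vector_field M) (w : bivector_field M).
Hypothesis hlor : lorentzian g.
Hypothesis hiso : isotropic g p.
Hypothesis hw : in_wedge_perp g p w.
Hypothesis hcl : forall c x, dom c x ->
  ('J (flat g p c \o par c) (coord c x))^T = 'J (flat g p c \o par c) (coord c x).

Lemma weakly_parallel_frame (D : connection M) m (S : 'M[R]_(m, n)) c x
    (v : 'rV[R]_n) : weakly_parallel g p w D -> dom c x ->
  flat g p c x *m S^T = 0 ->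
  (S *m g c x *m (\sum_i v 0 i *: nabla_bv D w c x i) <= p c x)%MS.
Proof.
move=> hD cx /perp_rows hS; rewrite sum_scale_mulr summx_sub// => i _.
rewrite scalemx_sub//; apply/row_subP => j; rewrite !row_mul.
exact: hD.
Qed.

Lemma torsion_shift_frame (D1 D2 : connection M) (k : R) m (S : 'M[R]_(m, n)) c x
    (v : 'rV[R]_n) : torsion_shift g p w D1 D2 k -> dom c x ->
  flat g p c x *m S^T = 0 ->
  (S *m (\sum_i v 0 i *: D1 c x i) - S *m (\sum_i v 0 i *: D2 c x i)
    - (k * dot (flat g p c x) v) *: (S *m Om g w c x) <= p c x)%MS.
Proof.
move=> hD cx /perp_rows hS; rewrite !sum_scale_mulr /dot mxE mulr_sumr.
rewrite scaler_suml -!sumrB summx_sub// => i _.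
rewrite [_^T _ _]mxE [flat g p c x 0 i * _]mulrC mulrCA -scalerA -!scalerBr.
rewrite scalemx_sub//; apply/row_subP => j.
rewrite !linearB/= linearZ/= !row_mul.
exact: hD.
Qed.

Lemma screen_basis_mx c x m (e S : 'M[R]_(m, n)) : screen_basis g p c x e ->
  flat g p c x *m S^T = 0 -> exists B : 'M[R]_m, (S - B *m e <= p c x)%MS.
Proof.
move=> [_ sp _] /perp_rows hS.
have : (S <= col_mx e (p c x))%MS by apply/row_subP => i; exact/sp/hS.
move=> /submxP[X ->]; exists (lsubmx X).
by rewrite -[X in X *m col_mx _ _]hsubmxK mul_row_col addrAC subrr add0r submxMl.
Qed.

(* Since omega is parallel, so is its value on a parallel frame; a constant
   linear relation holding at the start therefore persists. *)
Lemma Om_parallel_frame (D : connection M) m N (ga : R -> M)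
    (S : chart M -> R -> 'M[R]_(m, n)) (B : 'M[R]_m) :
  metric_connection g D -> weakly_parallel g p w D -> lift_frame g p N ga S ->
  (forall k, (k < N)%N -> exists ga', C1_on_segment k ga ga' /\
     exists S', parallel_frame_on p D k ga ga' S S') ->
  forall c0, dom c0 (ga 0) ->
  ((S c0 0 *m Om g w c0 (ga 0) - B *m S c0 0)%R <= p c0 (ga 0))%MS ->
  forall t, 0 <= t <= N%:R -> forall c, dom c (ga t) ->
  ((S c t *m Om g w c (ga t) - B *m S c t)%R <= p c (ga t))%MS.
Proof.
move=> hm hD hS hS' c0 c00 h0.
apply: (@parallel_frame_zero _ _ _ g p hlor hiso D m N ga
  (fun c t => S c t *m Om g w c (ga t) - B *m S c t)) c00 h0 => //.
- move=> t tN c ct; split.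
    rewrite linearB/= mulmxBr perp_Om// trmx_mul mulmxA.
    by rewrite (hS t tN c ct).1 mul0mx subr0.
  move=> d dt; rewrite ((hS t tN c ct).2 d dt) mulmxBl.
  have -> : S c t *m Om g w c (ga t) *m jac c d (ga t) =
      S c t *m (Om g w c (ga t) *m jac c d (ga t)) by rewrite mulmxA.
  by rewrite (Om_law g w ct dt) !mulmxA.
- move=> k kN; have [ga' [hga [S' hS1]]] := hS' k kN.
  exists ga'; split => //.
  (* Built from the extensions [S'] and [ga'], so as to be derivable at the break points too. *)
  exists (fun c t => S' c t *m (g c (ga' t) *m w c (ga' t)) - B *m S' c t).
  move=> t tk c ct; have [ge gC1] := hga t tk.
  have ct' : dom c (ga' t) by rewrite ge.
  have [SE SC1 pS] := hS1 t tk c ct.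
  split; first by rewrite SE ge.
  have DS := C1_at_derivable SC1.
  have Dg := is_derive_metric hm gC1 ct'.
  have Dw := is_derive_bivector w D gC1 ct'.
  have DO := is_derive_mulmx DS (is_derive_mulmx Dg Dw).
  have DB := is_derive_mulmx (is_derive_cst B t 1) DS.
  eexists; split; first exact: (is_deriveB DO DB).
  rewrite /= SE ge /cst mul0mx add0r.
  set G := Gam_along D ga' c t in pS *; set dS := derive1 _ _ in pS *.
  set Nw := \sum_i _ *: nabla_bv _ _ _ _ _.
  have NwP : (S c t *m g c (ga t) *m Nw <= p c (ga t))%MS.
    apply: weakly_parallel_frame => //.
    exact: (hS t (segment_sub kN tk) c ct).1.
  set gx := g c (ga t) in NwP *; set wx := w c (ga t).
  (* Leibniz rule: the connection terms from [g] and [w] cancel, leaving the covariant derivatives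
     of [S] and of omega, each zero modulo p. *)
  have -> : dS *m (gx *m wx) + S c t *m ((G *m gx + gx *m G^T) *m wx +
      gx *m (Nw - G^T *m wx - wx *m G)) - B *m dS +
      (S c t *m Om g w c (ga t) - B *m S c t) *m G =
      (dS + S c t *m G) *m Om g w c (ga t) + S c t *m gx *m Nw
      - B *m (dS + S c t *m G).
    rewrite /Om -/gx -/wx !(mulmxDl, mulmxDr, mulmxBl, mulmxBr, mulmxN, mulNmx).
    rewrite !mulmxA.
    move: (B *m dS) (B *m S c t *m G) (dS *m gx *m wx).
    move: (S c t *m G *m gx *m wx) (S c t *m gx *m G^T *m wx) (S c t *m gx *m Nw).
    move: (S c t *m gx *m wx *m G) => a1 a2 a3 a4 a5 a6 a7.
    by apply/matrixP => i j; rewrite !mxE; ring.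
  rewrite (sub_p_Om hw ct pS) add0r addmx_sub// eqmx_opp.
  exact: mulmx_sub.
Qed.

(** Stated for a pair of connections and a factor [kap] so that both inclusions are instances.
    Metricity and the parallelism of omega are asked of [D1], whose parallel frame is given; [D2]
    enters through its difference from [D1]. *)
Lemma screen_hol0_sub (D1 D2 : connection M) (kap : R) x c m (e : 'M[R]_(m, n)) :
  metric_connection g D1 -> weakly_parallel g p w D1 ->
  torsion_shift g p w D1 D2 kap -> dom c x -> screen_basis g p c x e ->
  screen_hol0 g p D1 c x e `<=` screen_hol0 g p D2 c x e.
Proof.
move=> hm hD hsh cx he a [N [ga [[ga0 gaN] hpw hnull hs]]].
have /choice[s sP] : forall i, exists s, screen_parallel_along g p D1 N ga s /\
    Defs.eqE p c x (s c 0) (row i e) /\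
    Defs.eqE p c x (s c N%:R) (row i (a *m e)).
  by move=> i; have [si h1 h2] := hs i; exists si.
have spar i := (sP i).1.
pose S c t := \matrix_i s i c t.
have hS : lift_frame g p N ga S := lift_frame_rows spar.
have hS' k : (k < N)%N -> exists ga', C1_on_segment k ga ga' /\
    exists S', parallel_frame_on p D1 k ga ga' S S'.
  move=> kN; have [ga' hga] := hpw k kN; exists ga'; split => //.
  exact: parallel_frame_exists kN hga spar.
(* [B] is the matrix of omega at [x] in the basis [e] of E_x. *)
have [B hB] := screen_basis_mx he (perp_Om hw e cx).
have N00 : 0 <= (0 : R) <= N%:R by rewrite lexx ler0n.
have NNN : 0 <= (N%:R : R) <= N%:R by rewrite lexx ler0n.
have S0e : (S c 0 - e <= p c x)%MS.
  by apply/row_subP => i; rewrite linearB/= rowK; exact: (sP i).2.1.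
have c0 : dom c (ga 0) by rewrite ga0.
(* The frame starts at [e] only modulo [p], but [Om] annihilates [p]. *)
have U0 : ((S c 0 *m Om g w c (ga 0) - B *m S c 0)%R <= p c (ga 0))%MS.
  rewrite ga0.
  have -> : S c 0 *m Om g w c x - B *m S c 0 =
     (S c 0 - e) *m Om g w c x + (e *m Om g w c x - B *m e) - B *m (S c 0 - e).
    rewrite mulmxBl mulmxBr; move: (B *m _) (B *m _) (_ *m Om _ _ _ _).
    move: (_ *m Om _ _ _ _) => a1 a2 a3 a4.
    by apply/matrixP => i j; rewrite !mxE; ring.
  rewrite (sub_p_Om hw cx S0e) add0r addmx_sub// eqmx_opp.
  exact: mulmx_sub.
have U := Om_parallel_frame hm hD hS hS' c0 U0.
have [P [P0 dP]] := mx_exp_exists B.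
have [th [thc thd]] := flat_cocycle hcl.
have [H [cH H1 H2]] := hnull.
have [h [h0 hN hh]] := loop_primitive thc cH H1 H2.
(* Here [h] is a primitive of theta itself; the factor 1/2 or - 1/2 is [kap]. *)
pose V c t := P (kap * h t) *m S c t.
exists N, ga; split => // i; exists (fun c t => row i (V c t)); last first.
  rewrite /V h0 hN mulr0 P0 !mul1mx !rowK; exact: (sP i).2.
split.
  move=> t tN d dt; have [f1 f2] := hS t tN d dt; split.
    apply: (perp_rows _ _ _ _ _).1; rewrite /V trmx_mul mulmxA f1 mul0mx.
    by [].
  by move=> d' dt'; rewrite /V (f2 d' dt') mulmxA row_mul.
move=> k kN; have [ga' [hga [S' hS1]]] := hS' k kN.
(* [h] is tied to theta along [ga] on [0, N] only; integrating along [ga'] continues it in a C^1 way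
   past the break points. *)
pose psi t r := kap * (h t + th (ga' t) (ga' r)).
have [||h' hh'] := @C1_extend _ (fun t => kap * h t) psi k%:R k.+1%:R.
- by rewrite ltr_nat.
- move=> t tk; have K := hh t (segment_sub kN tk).
  near=> r => rk; rewrite /psi (hga t tk).1 (hga r rk).1.
  have <- : h r - h t = th (ga t) (ga r).
    by have := segment_sub kN rk; near: r; exact: K.
  by rewrite addrC subrK.
exists ga', (fun c t => row i (P (h' t) *m S' c t)) => t tk.
have [ge gC1] := hga t tk; have [h'E h'psi] := hh' t tk.
split => // d dt.
have dt' : dom d (ga' t) by rewrite ge.
have [SE SC1 pS] := hS1 t tk d dt.
have [thC1 thD] := thd ga' t d gC1 dt'.
have [psiC1 psiD] := C1_at_affine kap (h t) thC1.
have h'C1 : C1_at h' t := C1_at_near_eq h'psi psiC1.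
have Dh' : is_derive t 1 h' (kap * dot (flat g p d (ga t)) (vel ga' d t)).
  apply: near_eq_is_derive h'psi _.
  by rewrite -ge -thD -psiD; exact: C1_at_derivable.
have VC1 : C1_at (fun t => P (h' t) *m S' d t) t.
  exact: C1_at_mulmx (C1_at_flow dP h'C1) SC1.
split.
- by rewrite h'E SE.
- apply/C1_at_mxP => i1 j1; have /C1_at_mxP/(_ i j1) := VC1.
  rewrite (_ : (fun r => (row i (P (h' r) *m S' d r)) i1 j1) =
     (fun r => (P (h' r) *m S' d r) i j1))//.
  by apply/funext => r; rewrite mxE.
- have DP : is_derive (h' t) 1 P (P (h' t) *m B) := dP _.
  have DPh := is_derive_scale_comp DP Dh'.
  have DV := is_derive_mulmx DPh (C1_at_derivable SC1).
  have DrV : is_derive t 1 (fun r => row i (P (h' r) *m S' d r))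
     (row i ((kap * dot (flat g p d (ga t)) (vel ga' d t)) *:
       (P (h' t) *m B) *m S' d t + (P \o h') t *m derive1 (S' d) t)).
    apply/is_derive_mxP => i1 j1; rewrite mxE.
    rewrite (_ : (fun r => (row i (P (h' r) *m S' d r)) i1 j1) =
       (fun r => (P (h' r) *m S' d r) i j1)).
      by move/is_derive_mxP : DV; apply.
    by apply/funext => r; rewrite mxE.
  rewrite derive1E (@derive_val _ _ _ _ _ _ _ DrV) /Defs.eqE subr0.
  rewrite -row_mul -linearD/= /V -h'E SE.
  apply: (submx_trans (row_sub _ _)).
  have K := torsion_shift_frame (vel ga' d t) hsh dt
     (hS t (segment_sub kN tk) d dt).1.
  have UU := U t (segment_sub kN tk) d dt.
  rewrite /Gam_along ge in pS.
  set G1 := \sum_i _ *: D1 _ _ _ in pS K; set G2 := \sum_i _ *: D2 _ _ _ in K.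
  rewrite -/G2.
  set kd := kap * dot _ _ in K *; set dS := derive1 _ _ in pS *.
  set O := Om g w d (ga t) in K UU; clearbody O.
  (* The [D2]-derivative of [V] splits into the [D1]-derivative of [S], the defect in
     [torsion_shift] and the defect of omega S = B S, each lying in the line of [p]. *)
  have -> : kd *: (P (h' t) *m B) *m S d t + P (h' t) *m dS +
      P (h' t) *m S d t *m G2 =
      P (h' t) *m (dS + S d t *m G1)
      - P (h' t) *m (S d t *m G1 - S d t *m G2 - kd *: (S d t *m O))
      - kd *: (P (h' t) *m (S d t *m O - B *m S d t)).
    rewrite !(mulmxDr, mulmxBr, mulmxN) -!scalemxAl -!scalemxAr !mulmxA.
    move: (P _ *m B *m _) (P _ *m dS) (P _ *m S d t *m G1) (P _ *m S d t *m G2).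
    move: (P _ *m S d t *m O) => a1 a2 a3 a4 a5.
    by apply/matrixP => i1 j1; rewrite !mxE; ring.
  rewrite addmx_sub ?eqmx_opp ?scalemx_sub ?mulmx_sub//.
  by rewrite addmx_sub ?eqmx_opp ?mulmx_sub.
Unshelve. all: by end_near. Qed.

End Holonomy.
Theorem proposition2 (R : realType) (n : nat) (M : manifold R n)
    (g : sym_form M) (nabla nablag : connection M)
    (p : vector_field M) (omega : bivector_field M)
    (hgeom : parallel_skew_torsion_geometry g nabla)
    (hLC : levi_civita g nablag)
    (hiso : isotropic g p)
    (hp : parallel_field nabla p)
    (homega : in_wedge_perp g p omega)
    (hT : torsion_is_wedge g p nabla omega)
    (hpar : parallel_on_screen g p nabla omega)
    (x : M) (c : chart M) (hx : dom c x)
    (m : nat) (e : 'M[R]_(m, n)) (he : screen_basis g p c x e) :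
  screen_hol_algebra g p nabla c x e = screen_hol_algebra g p nablag c x e.
Proof.
have [hlor hmet _ _] := hgeom.
have hcl := flat_closed homega hgeom hLC hiso hp hT.
(* The inclusion of restricted groups is applied to exp (t A) for each [t]. *)
apply/seteqP; split => A hA t.
- exact: (screen_hol0_sub hlor hiso homega hcl hmet
    (weakly_parallel_nabla hpar)
    (torsion_shift_nabla hgeom hLC hT) hx he (hA t)).
- exact: (screen_hol0_sub hlor hiso homega hcl hLC.2
    (weakly_parallel_nablag homega hgeom hLC hT hpar)
    (torsion_shift_nablag hgeom hLC hT) hx he (hA t)).
Qed.
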